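(* Let $G$ be a countable infinite discrete group and let $(C_n,F_{n-1})_{n\ge1}$ be a sequence of finite subsets of $G$ satisfying (I)–(IV). Let $X$ be the associated $(C,F)$-space, a locally compact Cantor space, and $\mathcal R$ the tail equivalence relation on $X$, a countable equivalence relation. Then: (i) every $\mathcal R$-class is dense in $X$; (ii) there is only one (up to scaling) $\mathcal R$-invariant non-trivial $\sigma$-finite Radon measure $\mu$ on $X$; (iii) $\mu$ is finite if and only if $\lim_{n\to\infty}\frac{\#F_n}{\#C_1\cdots\#C_n}<\infty$; (iv) there is a free topological $G$-action $T$ (the $(C,F)$-action) on an $\mathcal R$-invariant $G_\delta$-subset $X^G$ of $X$ such that the $T$-orbit equivalence relation is the restriction of $\mathcal R$ to $X^G$; (v) $X^G=X$ if and only if for each $g\in G$ and $n>0$ there is $m>n$ such that $gF_nC_{n+1}C_{n+2}\cdots C_m\subset F_m$; (vi) $\mu(X\setminus X^G)=0$ if and only if $$\lim_{m\to\infty}\frac{\#((gF_nC_{n+1}C_{n+2}\cdots C_m)\cap F_m)}{\#F_n\,\#C_{n+1}\cdots\#C_m}=1\quad\text{for each }g\in G,\ n>0;\qquad(\ast)$$ moreover, if $(\ast)$ is not satisfied then $\mu(X^G)=0$; (vii) if $\mu(X)<\infty$ then $(\ast)$ is equivalent to the fact that $(F_n)_{n\ge0}$ is a Følner sequence in $G$; (viii) under $(\ast)$, the dynamical system $(X,\mu,T)$ is ergodic, conservative and of funny rank one.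
   Context: **Conditions.** $(F_n)_{n\ge0}$, $(C_n)_{n\ge1}$ are finite subsets of $G$ with: (I) $F_0=\{1\}$, $\#C_n>1$; (II) $F_nC_{n+1}\subset F_{n+1}$; (III) $F_nc\cap F_nc'=\emptyset$ for distinct $c,c'\in C_{n+1}$; (IV) $1\in\bigcap_{n\ge0}F_n\cap\bigcap_{n\ge1}C_n$. **$(C,F)$-space.** $X_n=F_n\times C_{n+1}\times C_{n+2}\times\cdots$ with the product topology, embedded into $X_{n+1}$ by $(f_n,c_{n+1},c_{n+2},\dots)\mapsto(f_nc_{n+1},c_{n+2},\dots)$; $X$ is the topological inductive limit of $X_0\subset X_1\subset\cdots$. A (locally compact) Cantor space is a (locally compact) totally disconnected perfect metrizable space. $\mathcal R$ is the equivalence relation on $X$ whose restriction to each $X_n$ is the tail equivalence relation (sequences agreeing from some coordinate on). A measure is $\mathcal R$-invariant if it is invariant under each Borel transformation whose graph is contained in $\mathcal R$; Radon means finite on compact sets. **$(C,F)$-action.** For $g\in G$ let $X_n^g=\{(f_n,c_{n+1},\dots)\in X_n: gf_n\in F_n\}$, $X^g=\bigcup_{n\ge0}X_n^g$, $X^G=\bigcap_{g\in G}X^g$. For $x\in X^G$ and $g\in G$ choose $n$ with $x=(f_n,c_{n+1},\dots)\in X_n$ and $gf_n\in F_n$, and put $T_gx=(gf_n,c_{n+1},\dots)\in X_n$. **Følner**: $\#(gF_n\cap F_n)/\#F_n\to1$ for each $g\in G$. **Funny rank one**: a measure preserving $G$-action on a standard $\sigma$-finite space $(X,\mathfrak B,\mu)$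 such that there are finite-measure sets $B_n$ and finite sets $F_n\subset G$ ($n\ge0$) for which the sets $T_gB_n$, $g\in F_n$, are pairwise disjoint for each $n$, and $\lim_n\inf_{F\subset F_n}\mu(B\triangle\bigsqcup_{g\in F}T_gB_n)=0$ for each $B\in\mathfrak B$ with $\mu(B)<\infty$. *)

(* Defs.v *)
From HB Require Import structures.
From mathcomp Require Import all_boot all_order all_algebra finmap zify.
From mathcomp Require Import all_classical all_reals all_analysis.

Set Implicit Arguments.
Unset Strict Implicit.
Unset Printing Implicit Defensive.

Import Order.TTheory GRing.Theory Num.Theory.
Import numFieldTopology.Exports.
Local Open Scope classical_set_scope.
Local Open Scope quotient_scope.
Local Open Scope ring_scope.

Definition homeomorphic (X Y : topologicalType) : Prop :=
  exists (f : X -> Y) (g : Y -> X),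
    [/\ cancel f g, cancel g f, continuous f & continuous g].

Definition metrizable (R : realType) (X : topologicalType) : Prop :=
  exists M : metricType R, homeomorphic X M.

Definition locally_compact_cantor (R : realType) (X : topologicalType) : Prop :=
  [/\ locally_compact [set: X], totally_disconnected [set: X],
      perfect_set [set: X] & metrizable R X].

(* A Hausdorff pseudometric is a metric, so [M] below is a Polish space. *)
Definition standard_borel (R : realType) d (T : measurableType d) : Prop :=
  exists (M : completePseudoMetricType R) (f : T -> M),
    [/\ hausdorff_space M,
        exists2 S : set M, countable S & dense S,
        bijective f &
        forall A : set T, measurable A <-> <<s (@open M) >> (f @` A)].

Section FiniteSubsets.
Context {G : groupType}.
Implicit Types A B F : {fset G}.

Definition fsetM A B : {fset G} := [fset (a * b)%g | a in A, b in B]%fset.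

Definition ltrans (g : G) A : {fset G} := [fset (g * a)%g | a in A]%fset.

Definition rtrans A (c : G) : {fset G} := [fset (a * c)%g | a in A]%fset.

Definition folner (R : realType) (F : nat -> {fset G}) : Prop :=
  forall g : G,
    (fun n => (#|` (ltrans g (F n) `&` F n)%fset|)%:R / (#|` F n|)%:R : R)
      @ \oo --> (1 : R).

End FiniteSubsets.

(* [cfC D 0] plays no role: the sets C_n are indexed by n >= 1. *)
Record cf_seq (G : groupType) := CFSeq {
  cfF : nat -> {fset G};
  cfC : nat -> {fset G};
  cf_F0 : cfF 0 = [fset 1%g]%fset;
  cf_card_C : forall n, (1 < #|` cfC n.+1|)%N;
  cf_FC_sub : forall n, (fsetM (cfF n) (cfC n.+1) `<=` cfF n.+1)%fset;
  cf_disj : forall n c c', c \in cfC n.+1 -> c' \in cfC n.+1 -> c != c' ->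
    (rtrans (cfF n) c `&` rtrans (cfF n) c')%fset = fset0;
  cf_1F : forall n, 1%g \in cfF n;
  cf_1C : forall n, 1%g \in cfC n.+1
}.

Section CFSpace.
Context {G : groupType} (D : cf_seq G).
Local Notation F := (cfF D).
Local Notation C := (cfC D).

(* F_n C_{n+1} C_{n+2} ... C_m; the fold multiplies the C_i in increasing
   order of i. *)
Definition cf_prod (n m : nat) : {fset G} :=
  fsetM (F n) (\big[fsetM/[fset 1%g]%fset]_(n.+1 <= i < m.+1) C i).

Definition cf_card (n m : nat) : nat :=
  (#|` F n| * \prod_(n.+1 <= i < m.+1) #|` C i|)%N.

(* A point (f, c) stands for (f_n, c_{n+1}, c_{n+2}, ...) with f_n = f and
   c_{n+1+k} = c k. *)
Definition cf_ambient : topologicalType :=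
  (discrete_topology G * prod_topology (fun _ : nat => discrete_topology G))%type.

Definition cf_level_set (n : nat) : set cf_ambient :=
  [set x | (x.1 : G) \in F n /\ forall k, (x.2 k : G) \in C (n + k).+1].

Definition cf_level (n : nat) : topologicalType := set_type (cf_level_set n).

Definition cf_step (x : cf_ambient) : cf_ambient :=
  ((x.1 * x.2 0%N)%g : G, fun k => x.2 k.+1).

Lemma cf_step_level n x : cf_level_set n x -> cf_level_set n.+1 (cf_step x).
Proof.
case=> xF xC; split=> [|k] /=; last by rewrite addSnnS.
apply: (fsubsetP (cf_FC_sub D n)); apply/imfset2P.
exists x.1 => //; exists (x.2 0%N) => //.
by have := xC 0%N; rewrite addn0.
Qed.

Definition cf_embed (n : nat) (a : cf_level n) : cf_level n.+1 :=
  SigSub (mem_set (cf_step_level (set_valP a))).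

(* Points of two levels are identified when their images in some common level
   coincide. *)
Definition cf_eqv (p q : {n : nat & cf_level n}) : bool :=
  `[< exists i j, (projT1 p + i = projT1 q + j)%N /\
      iter i cf_step (set_val (projT2 p)) =
      iter j cf_step (set_val (projT2 q)) >].

Lemma cf_eqv_refl : reflexive cf_eqv.
Proof. by move=> p; apply/asboolP; exists 0%N, 0%N. Qed.

Lemma cf_eqv_sym : symmetric cf_eqv.
Proof.
by move=> p q; apply/asboolP/asboolP => -[i [j [e1 e2]]]; exists j, i.
Qed.

Lemma cf_eqv_trans : transitive cf_eqv.
Proof.
move=> q p r /asboolP[i [j [e1 e2]]] /asboolP[k [l [e3 e4]]].
apply/asboolP; exists (k + i)%N, (j + l)%N; split.
  by rewrite (addnC k) addnA e1 addnAC e3 -addnA (addnC l).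
by rewrite !iterD e2 -e4 -!iterD addnC.
Qed.

Canonical cf_equiv := EquivRel cf_eqv cf_eqv_refl cf_eqv_sym cf_eqv_trans.


(* The disjoint union of the levels modulo [cf_eqv], with the final topology:
   the topological inductive limit of X_0 -> X_1 -> ... *)
Definition cf_space : Type := quotient_topology {eq_quot cf_equiv}.

HB.instance Definition _ := Topological.copy cf_space
  (quotient_topology {eq_quot cf_equiv}).

Definition cf_in (n : nat) (a : cf_level n) : cf_space :=
  (\pi_(quotient_topology {eq_quot cf_equiv}) (existT _ n a)).

Lemma cf_in_embed n (a : cf_level n) : cf_in (cf_embed a) = cf_in a.
Proof. by apply/eqquotP/asboolP; exists 0%N, 1%N; split; rewrite //= addn1 addn0. Qed.

Lemma cf_step_inj n x y : cf_level_set n x -> cf_level_set n y ->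
  cf_step x = cf_step y -> x = y.
Proof.
case: x y => [f c] [f' c'] [/= fF cC] [/= fF' cC'] [effc ecc].
have c0 : c 0%N = c' 0%N.
  apply/eqP; apply: contraT => nc.
  have /= cC0 := cC 0%N; have /= cC0' := cC' 0%N; rewrite addn0 in cC0 cC0'.
  have /fsetP/(_ (f * c 0%N)%g) := cf_disj cC0 cC0' nc.
  rewrite in_fset0 in_fsetI => /negbT/negP; case; apply/andP; split.
    by apply/imfsetP; exists f.
  by apply/imfsetP; exists f'.
congr (_, _); first by move: effc; rewrite c0 => /mulIg.
by apply/funext => -[//|k]; exact: (congr1 (@^~ k) ecc).
Qed.

Lemma cf_in_inj n : injective (@cf_in n).
Proof.
move=> a b /eqquotP/asboolP[i [j [/= /addnI <-{j} e]]].
suff inj m x y : cf_level_set m x -> cf_level_set m y ->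
    iter i cf_step x = iter i cf_step y -> x = y.
  by apply/val_inj; exact: (inj n _ _ (set_valP a) (set_valP b) e).
elim: {e} i m x y => [//|i IH] m x y xm ym; rewrite !iterSr => e.
by apply: (cf_step_inj xm ym); apply: (IH m.+1) => //; exact: cf_step_level.
Qed.

Lemma cf_base_subproof : cf_level_set 0 ((1%g : G), fun=> (1%g : G)).
Proof. by split=> [|k] /=; [exact: cf_1F|exact: cf_1C]. Qed.

Definition cf_base : cf_space :=
  cf_in (SigSub (mem_set cf_base_subproof) : cf_level 0).

HB.instance Definition _ := isPointed.Build cf_space cf_base.

HB.instance Definition _ := Measurable.copy cf_space
  (g_sigma_algebraType (@open cf_space)).

Definition cf_tail : cf_space -> cf_space -> Prop := fun x y =>
  exists n (a b : cf_level n), [/\ x = cf_in a, y = cf_in b &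
    exists N, forall k, (N <= k)%N -> (set_val a).2 k = (set_val b).2 k].

Lemma iter_cf_step2 i (x : cf_ambient) k :
  (iter i cf_step x).2 k = x.2 (i + k)%N.
Proof. by elim: i k => [//|i IH] k /=; rewrite IH addnS. Qed.

(* The restriction of [cf_tail] to every X_n is the tail relation of X_n. *)
Lemma cf_tailP n (a b : cf_level n) :
  cf_tail (cf_in a) (cf_in b) <->
  exists N, forall k, (N <= k)%N -> (set_val a).2 k = (set_val b).2 k.
Proof.
split=> [|ab]; last by exists n, a, b.
move=> [m [a' [b' [/eqquotP/asboolP[i [j /= [nm ea]]]]]]].
move=> /eqquotP/asboolP[i' [j' /= [nm' eb]]] [N a'b'].
exists (N + n + m + i + j + i' + j')%N => k Nk.
have /(congr1 (fun x : cf_ambient => x.2 (k - i)%N)) := ea.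
have /(congr1 (fun x : cf_ambient => x.2 (k - i')%N)) := eb.
rewrite !iter_cf_step2 !subnKC; [|lia|lia] => -> ->.
rewrite a'b'; last by lia.
by congr (_ _); lia.
Qed.

(* X_n^g as a subset of X, then X^g and X^G. *)
Definition cf_dom_level (n : nat) (g : G) : set cf_space :=
  @cf_in n @` [set a | (g * (set_val a).1)%g \in F n].

Definition cf_dom (g : G) : set cf_space := \bigcup_n cf_dom_level n g.

Definition cf_full : set cf_space := \bigcap_g cf_dom g.

(* x = (f_n, c_{n+1}, ...) and y = (g f_n, c_{n+1}, ...) in some X_n; the
   constraint g f_n \in F_n is [b : cf_level n]. *)
Definition cf_translate (g : G) (x y : cf_space) : Prop :=
  exists n (a b : cf_level n), [/\ x = cf_in a, y = cf_in b,
    (set_val b).1 = (g * (set_val a).1)%g & (set_val b).2 = (set_val a).2].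

(* Only meaningful on [cf_full]; outside [cf_dom g] it is the identity. *)
Definition cf_action (g : G) (x : cf_space) : cf_space :=
  xget x [set y | cf_translate g x y].

End CFSpace.

Arguments cf_level_set {G} D n _.
Arguments cf_tail {G} D _ _.
Arguments cf_dom_level {G} D n g _.
Arguments cf_dom {G} D g _.
Arguments cf_full {G} D _.
Arguments cf_translate {G} D g _ _.
Arguments cf_action {G} D g _.

Section Actions.
Context {G : groupType} {X : Type}.
Implicit Types (Y : set X) (T : G -> X -> X) (E : X -> X -> Prop).

Definition is_action Y T : Prop :=
  [/\ forall g x, Y x -> Y (T g x),
      forall x, Y x -> T 1%g x = x &
      forall g h x, Y x -> T (g * h)%g x = T g (T h x)].

Definition free_action Y T : Prop :=
  forall g x, Y x -> T g x = x -> g = 1%g.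

Definition invariant_set E Y : Prop := forall x y, E x y -> Y x -> Y y.

Definition countable_equivalence E : Prop :=
  [/\ forall x, E x x, forall x y, E x y -> E y x,
      forall x y z, E x y -> E y z -> E x z &
      forall x, countable [set y | E x y]].

End Actions.

(* G is discrete: joint continuity amounts to the continuity of each T_g. *)
Definition topological_action (G : groupType) (X : topologicalType)
    (Y : set X) (T : G -> X -> X) : Prop :=
  is_action Y T /\ forall g, {within Y, continuous (T g)}.

Definition borel_transformation d (X : measurableType d) (S : X -> X) : Prop :=
  [/\ bijective S, measurable_fun [set: X] S &
      forall A, measurable A -> measurable (S @` A)].

Definition relation_invariant (R : realType) d (X : measurableType d)
    (E : X -> X -> Prop) (mu : set X -> \bar R) : Prop :=
  forall S : X -> X, borel_transformation S -> (forall x, E x (S x)) ->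
  forall A, measurable A -> mu (S @^-1` A) = mu A.

Definition cf_measure (R : realType) (G : groupType) (D : cf_seq G)
    (mu : {measure set (cf_space D) -> \bar R}) : Prop :=
  [/\ relation_invariant (cf_tail D) mu,
      mu [set: cf_space D] <> 0%E,
      sigma_finite [set: cf_space D] mu &
      forall K : set (cf_space D), compact K -> (mu K < +oo)%E].

Section Ergodic.
Context {R : realType} {G : groupType} d (X : measurableType d).
Variables (mu : {measure set X -> \bar R}) (Y : set X) (T : G -> X -> X).
Local Open Scope ereal_scope.

Definition measure_preserving_action : Prop :=
  [/\ is_action Y T, measurable Y, mu (~` Y) = 0 &
      forall g A, measurable A -> A `<=` Y ->
        measurable (T g @` A) /\ mu (T g @` A) = mu A].

Definition ergodic : Prop :=
  forall A, measurable A -> A `<=` Y -> (forall g, T g @` A = A) ->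
  mu A = 0 \/ mu (~` A) = 0.

Definition conservative : Prop :=
  forall A, measurable A -> A `<=` Y -> 0 < mu A ->
  exists2 g, g <> 1%g & 0 < mu (A `&` T g @` A).

Definition funny_rank_one : Prop :=
  [/\ standard_borel R X, sigma_finite [set: X] mu, measure_preserving_action &
  exists (B : nat -> set X) (F : nat -> {fset G}),
    [/\ forall n, [/\ measurable (B n), B n `<=` Y & mu (B n) < +oo],
        forall n, trivIset [set` F n] (fun g => T g @` B n) &
        forall A, measurable A -> mu A < +oo ->
          (fun n => ereal_inf
            [set mu (A `+` \bigcup_(g in [set` F']) (T g @` B n)) | F' in
              [set F' : {fset G} | (F' `<=` F n)%fset]]) @ \oo --> 0]].

End Ergodic.

(* Main.v *)
Require Import Defs.
From HB Require Import structures.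
From mathcomp Require Import all_boot all_order all_algebra finmap.
From mathcomp Require Import all_classical all_reals all_analysis borel_hierarchy.
From mathcomp Require Import ring.

Set Implicit Arguments.
Unset Strict Implicit.
Unset Printing Implicit Defensive.

Import Order.TTheory GRing.Theory Num.Theory.
Import numFieldTopology.Exports.
Local Open Scope classical_set_scope.
Local Open Scope ring_scope.

(* A point of X_n is encoded by its heads hd m x = f_n c_{n+1} ... c_m, m >= n;
   the tail relation becomes "hd m y = g * hd m x for all large m", i.e. the
   union over g of the partial left translations, and the cylinders
   cyl n f = {x in X_n | f_n = f} form a base of compact open sets.  An
   invariant Radon measure gives the same mass to all cylinders of a level, as
   swapping two of them is a Borel transformation inside the tail relation; so
   cyl n f has mass mu(X_0) / (#C_1 ... #C_n), which determines the measure.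
   Conversely a Borel transformation inside the tail relation is piecewise a
   partial translation, so equal masses imply invariance; existence comes from
   laying the towers out on the half-line (cutting and stacking) and pushing
   Lebesgue measure forward.  Uniqueness applied to the restriction of mu to an
   invariant set gives ergodicity.  The quotients in (vi) and (vii) are
   mu(X_n & X_m^g) / mu(X_n) and mu(X_m^g) / mu(X_m), whose limits are given by
   continuity of mu from below. *)

(** * Heads and cylinders *)

(** The coordinates of a point change with the level at which it is viewed, whereas the embeddings
    leave the heads alone, so statements on heads need no choice of representative. The obstacle is
    that translations are only partially defined, since [g f_n] may leave F_n. The arguments
    therefore run on the relation [shift g], and the action is its restriction to the points where
    every [shift g] is defined. These points form an invariant set, so ergodicity of the tail
    relation gives the dichotomy in (vi). Conservativity rests on [#C_n >= 2]: the part in X_n of a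
    set meeting each orbit at most once can be packed into one cylinder, of mass at most
    [c / 2 ^ n]. For funny rank one, the n-th tower has the cylinder of the identity as base and F_n
    as shape. *)

Section Heads.
Context {G : groupType} (D : cf_seq G).
Local Notation F := (cfF D).
Local Notation C := (cfC D).
Local Notation X := (cf_space D).
Implicit Types (x y z : X) (n m k : nat) (f g : G).

(* lev n is X_n as a subset of X, and hd n x is the F_n-coordinate of a point x
   of X_n; hd n x is junk when x is not in X_n. *)
Definition lev n : set X := range (@cf_in G D n).

Definition hd n x : G :=
  xget 1%g [set f | exists2 a : cf_level D n, cf_in a = x & (set_val a).1 = f].

Definition cyl n f : set X := [set x | lev n x /\ hd n x = f].

Lemma hd_in n (a : cf_level D n) : hd n (cf_in a) = (set_val a).1.
Proof.
rewrite /hd; case: xgetP => [f -> [b /cf_in_inj <-]//|].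
by move=> /(_ (set_val a).1) []; exists a.
Qed.

Lemma lev_in n (a : cf_level D n) : lev n (cf_in a).
Proof. by exists a. Qed.

Lemma cf_inP n (x : X) : lev n x -> exists a : cf_level D n, cf_in a = x.
Proof. by case=> a _ <-; exists a. Qed.

Lemma lev_exists x : exists n, lev n x.
Proof.
have [n [a xa]] : exists n (a : cf_level D n), x = cf_in a.
  exists (projT1 (repr x)), (projT2 (repr x)).
  rewrite /cf_in -[LHS](@reprK _ _ x).
  by case: (repr x).
by exists n; rewrite xa; exact: lev_in.
Qed.

Lemma iter_embed k n (a : cf_level D n) :
  exists2 b : cf_level D (n + k), cf_in b = cf_in a &
    set_val b = iter k (@cf_step G) (set_val a).
Proof.
elim: k => [|k [b ba bE]].
  by rewrite addn0; exists a.
by rewrite addnS; exists (cf_embed b); [rewrite cf_in_embed|rewrite /= -bE].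
Qed.

Lemma hd_iter k n (a : cf_level D n) :
  hd (n + k) (cf_in a) = (iter k (@cf_step G) (set_val a)).1.
Proof. by have [b <- <-] := iter_embed k a; rewrite hd_in. Qed.

Lemma lev_leq n m : (n <= m)%N -> lev n `<=` lev m.
Proof.
move=> /subnKC <- x /cf_inP[a <-].
by have [b <- _] := iter_embed (m - n) a; exact: lev_in.
Qed.

Lemma hdF n x : lev n x -> hd n x \in F n.
Proof. by case/cf_inP => a <-; rewrite hd_in; case: (set_valP a). Qed.

Lemma hdS n k (a : cf_level D n) :
  hd (n + k).+1 (cf_in a) = (hd (n + k) (cf_in a) * (set_val a).2 k)%g.
Proof. by rewrite -addnS !hd_iter /= iter_cf_step2 addn0. Qed.

Lemma hdC n m x : lev n x -> (n <= m)%N -> ((hd m x)^-1 * hd m.+1 x)%g \in C m.+1.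
Proof.
case/cf_inP => a <- /subnKC <-; rewrite hdS mulgA mulVg mul1g.
by case: (set_valP a) => _; exact.
Qed.

(** Successive quotients of heads are the coordinates c_{m+1}, so the heads from level [n] on carry
    all the data of a point of X_n. *)
Lemma lev_ext n x y : lev n x -> lev n y ->
  (forall m, (n <= m)%N -> hd m x = hd m y) -> x = y.
Proof.
case/cf_inP => a <- /cf_inP[b <-] e; congr cf_in; apply/val_inj.
rewrite [LHS]surjective_pairing [RHS]surjective_pairing; congr (_, _).
  by have := e n (leqnn _); rewrite !hd_in.
apply/funext => k; have := e (n + k).+1; rewrite !hdS e ?leq_addr//.
by rewrite leqW ?leq_addr// => /(_ isT) /mulgI.
Qed.

(** The converse of [hdF] and [hdC]; new points are built from a prescribed sequence of heads
    through this lemma. *)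
Lemma lev_make n (h : nat -> G) : h n \in F n ->
  (forall m, (n <= m)%N -> ((h m)^-1 * h m.+1)%g \in C m.+1) ->
  exists2 x, lev n x & forall m, (n <= m)%N -> hd m x = h m.
Proof.
move=> hn hC.
have aP : cf_level_set D n (h n, fun k => ((h (n + k)%N)^-1 * h (n + k)%N.+1)%g).
  by split=> //= k; apply: hC; rewrite leq_addr.
pose a : cf_level D n := SigSub (mem_set aP).
exists (cf_in a); first exact: lev_in.
move=> m /subnKC <-; elim: (m - n)%N => [|k IH]; first by rewrite addn0 hd_in.
by rewrite addnS hdS IH /= mulgA mulgV mul1g.
Qed.

(* Splitting off the last factor c of a head f * c recovers the head f one
   level below: by condition (III) this factorisation is unique. *)
Lemma lev_down n f c y : f \in F n -> c \in C n.+1 -> lev n.+1 y ->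
  hd n.+1 y = (f * c)%g -> cyl n f y.
Proof.
move=> fF cC ly hy.
(* The heads of [y] preceded by [f] at level [n]: they define a point of X_n that agrees with [y]
   from level [n.+1] on. *)
pose h m := if m == n then f else hd m y.
have hC m : (n <= m)%N -> ((h m)^-1 * h m.+1)%g \in C m.+1.
  rewrite /h => nm; case: eqVneq => [->|mn].
    by rewrite (gtn_eqF (ltnSn n)) hy mulgA mulVg mul1g.
  rewrite gtn_eqF ?ltnS//.
  by apply: (hdC ly); rewrite ltn_neqAle eq_sym mn.
have hn : h n \in F n by rewrite /h eqxx.
have [z lz hz] := lev_make hn hC.
suff <- : z = y by split=> //; rewrite hz // /h eqxx.
apply: (lev_ext (lev_leq (leqnSn n) lz) ly) => m nm.
by rewrite hz ?(ltnW nm)// /h gtn_eqF.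
Qed.

Lemma cyl_lev n f : cyl n f `<=` lev n. Proof. by move=> x []. Qed.

Lemma cyl_hd n x : lev n x -> cyl n (hd n x) x. Proof. by []. Qed.

Lemma cyl_F n f x : cyl n f x -> f \in F n.
Proof. by move=> [lx <-]; exact: hdF. Qed.

Lemma cyl_eq n f g x : cyl n f x -> cyl n g x -> f = g.
Proof. by move=> [_ <-] [_ <-]. Qed.

(** Peeling off one factor at a time with [lev_down], a head at level [m] determines the earlier
    ones. Membership of [y] in the smaller X_n comes out as well, although only X_m is assumed. *)
Lemma hd_leq n m x y : (n <= m)%N -> lev n x -> cyl m (hd m x) y ->
  cyl n (hd n x) y.
Proof.
move=> /subnKC <-; elim: (m - n)%N => [|k IH] lx; first by rewrite addn0.
rewrite addnS => -[ly hy]; apply: IH => //.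
apply: (@lev_down _ _ ((hd (n + k) x)^-1 * hd (n + k).+1 x)%g) => //.
- by apply/hdF/(lev_leq _ lx)/leq_addr.
- by apply: (hdC lx); rewrite leq_addr.
- by rewrite hy mulgA mulgV mul1g.
Qed.

Lemma cyl_sub n m x : (n <= m)%N -> lev n x ->
  cyl m (hd m x) `<=` cyl n (hd n x).
Proof. by move=> nm lx y; exact: hd_leq. Qed.

Lemma C_gt0 n : (0 < #|` C n.+1|)%N.
Proof. exact: ltnW (cf_card_C D n). Qed.

Lemma cylS n f : f \in F n ->
  cyl n f = \bigcup_(c in [set` C n.+1]) cyl n.+1 (f * c)%g.
Proof.
move=> fF; apply/seteqP; split=> [x [lx hx]|x [c /= cC [lx hx]]].
  exists ((hd n x)^-1 * hd n.+1 x)%g; first exact: (hdC lx).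
  by split; [exact: lev_leq lx|rewrite -hx mulgA mulgV mul1g].
exact: (lev_down fF cC).
Qed.

Lemma FC_mul n f c : f \in F n -> c \in C n.+1 -> (f * c)%g \in F n.+1.
Proof.
move=> fF cC; apply: (fsubsetP (cf_FC_sub D n)); apply/imfset2P.
by exists f => //; exists c.
Qed.

Lemma cyl_nonempty n f : f \in F n -> cyl n f !=set0.
Proof.
(* As 1 lies in every C_m, the constant sequence of heads [f] is admissible. *)
move=> fF; have oneC m : (n <= m)%N -> (f^-1 * f)%g \in C m.+1.
  by rewrite mulVg => _; exact: cf_1C.
have [x lx hx] := @lev_make n (fun=> f) fF oneC.
by exists x; split=> //; rewrite hx.
Qed.

(** Condition (III) seen through points: a point with head [f * c] lies in the cylinders of both [f]
    and [f'], and a point has one head per level. *)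
Lemma FC_inj n f f' c c' : f \in F n -> f' \in F n -> c \in C n.+1 ->
  c' \in C n.+1 -> (f * c = f' * c')%g -> f = f' /\ c = c'.
Proof.
move=> fF f'F cC c'C e.
have [x [lx hx]] := cyl_nonempty (FC_mul fF cC).
have x1 := lev_down fF cC lx hx; rewrite e in hx.
have x2 := lev_down f'F c'C lx hx.
have ff' := cyl_eq x1 x2; split=> //; move: e; rewrite ff'.
exact: mulgI.
Qed.

Lemma cyl_trivIset n (A : set G) : trivIset A (cyl n).
Proof. by move=> f g _ _ [x [xf xg]]; exact: cyl_eq xf xg. Qed.

Lemma levE n : lev n = \bigcup_(f in [set` F n]) cyl n f.
Proof.
apply/seteqP; split=> [x lx|x [f _ []//]].
by exists (hd n x) => //; exact: hdF.
Qed.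

Lemma lev_cover : \bigcup_n lev n = setT.
Proof.
by apply/seteqP; split=> // x _; have [n lx] := lev_exists x; exists n.
Qed.

(* In terms of heads, the tail relation is the union of all partial left
   translations. *)
Definition shift g : X -> X -> Prop := fun x y =>
  exists n, [/\ lev n x, lev n y & forall m, (n <= m)%N -> hd m y = (g * hd m x)%g].

Lemma translateP g x y : cf_translate D g x y <-> shift g x y.
Proof.
split=> [[n [a [b [-> -> ab1 ab2]]]]|[n [/cf_inP[a <-] /cf_inP[b <-] e]]].
  exists n; split; [exact: lev_in|exact: lev_in|move=> m /subnKC <-].
  elim: (m - n)%N => [|k IH]; first by rewrite addn0 !hd_in.
  by rewrite addnS !hdS IH ab2 mulgA.
exists n, a, b; split=> //.
  by have := e n (leqnn n); rewrite !hd_in.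
apply/funext => k; have := e (n + k).+1; rewrite !hdS e ?leq_addr//.
by rewrite leqW ?leq_addr// => /(_ isT); rewrite -mulgA => /mulgI/mulgI.
Qed.

Lemma tailP x y : cf_tail D x y <-> exists g, shift g x y.
Proof.
split=> [[n [a [b [-> -> [N ab]]]]]|[g [n [/cf_inP[a <-] /cf_inP[b <-] e]]]].
  pose M := (n + N)%N; exists (hd M (cf_in b) * (hd M (cf_in a))^-1)%g, M; split.
  - exact: lev_leq (leq_addr _ _) _ (lev_in a).
  - exact: lev_leq (leq_addr _ _) _ (lev_in b).
  - move=> m /subnKC <-; elim: (m - M)%N => [|k IH].
      by rewrite addn0 -mulgA mulVg mulg1.
    rewrite addnS /M -!addnA !hdS !addnA IH mulgA; congr (_ * _)%g.
    by rewrite ab// leq_addr.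
exists n, a, b; split=> //; exists 0%N => k _.
have := e (n + k).+1; rewrite !hdS e ?leq_addr// leqW ?leq_addr//.
by move=> /(_ isT); rewrite -mulgA => /mulgI/mulgI.
Qed.

(** Left multiplication does not change the increments of the heads, so a single admissible head
    [g * hd n x] makes all later ones admissible. *)
Lemma shift_ex n g x : lev n x -> (g * hd n x)%g \in F n ->
  exists2 y, lev n y & forall m, (n <= m)%N -> hd m y = (g * hd m x)%g.
Proof.
move=> lx gF; apply: (@lev_make n (fun m => g * hd m x)%g gF) => m nm.
rewrite invgM -mulgA (mulgA g^-1%g) mulVg mul1g.
exact: (hdC lx).
Qed.

Lemma shift_fun g x y z : shift g x y -> shift g x z -> y = z.
Proof.
move=> [n [xn yn e]] [m [xm zm e']].
apply: (@lev_ext (maxn n m)) => [||k].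
- exact: lev_leq (leq_maxl _ _) _ yn.
- exact: lev_leq (leq_maxr _ _) _ zm.
- by rewrite geq_max => /andP[nk mk]; rewrite e ?e'.
Qed.

Lemma shift_free g x : shift g x x -> g = 1%g.
Proof.
move=> [n [_ _ /(_ n (leqnn n)) e]].
by apply: (@mulIg _ (hd n x)); rewrite -e mul1g.
Qed.

Lemma shift1 x : shift 1%g x x.
Proof. by have [n lx] := lev_exists x; exists n; split=> // m _; rewrite mul1g. Qed.

Lemma shiftM g h x y z : shift h x y -> shift g y z -> shift (g * h)%g x z.
Proof.
move=> [n [xn yn e]] [m [ym zm e']]; exists (maxn n m); split.
- exact: lev_leq (leq_maxl _ _) _ xn.
- exact: lev_leq (leq_maxr _ _) _ zm.
- by move=> k; rewrite geq_max => /andP[nk mk]; rewrite e' ?e ?mulgA.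
Qed.

Lemma shiftV g x y : shift g x y -> shift g^-1%g y x.
Proof.
move=> [n [xn yn e]]; exists n; split=> // m nm.
by rewrite e// mulgA mulVg mul1g.
Qed.

Lemma domP g x : cf_dom D g x <-> exists2 n, lev n x & (g * hd n x)%g \in F n.
Proof.
split=> [[n _ [a /= gF <-]]|[n /cf_inP[a <-]]].
  by exists n; [exact: lev_in|rewrite hd_in].
by rewrite hd_in => gF; exists n => //; exists a.
Qed.

Lemma dom_shift g x : cf_dom D g x <-> exists y, shift g x y.
Proof.
split=> [/domP[n lx gF]|[y [n [lx ly e]]]].
  by have [y ly hy] := shift_ex lx gF; exists y, n.
by apply/domP; exists n => //; rewrite -e//; exact: hdF.
Qed.

Lemma dom_leq n m g x : (n <= m)%N -> lev n x -> (g * hd n x)%g \in F n ->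
  (g * hd m x)%g \in F m.
Proof.
move=> nm lx gF; have [y ly <-//] := shift_ex lx gF.
exact/hdF/(lev_leq nm).
Qed.

Lemma fullP x : cf_full D x <-> forall g, exists y, shift g x y.
Proof. by split=> [h g|h g _]; apply/dom_shift; [exact: (h g)|exact: h]. Qed.

(** Translating [y] by [h] amounts to translating [x] by [h * g]. *)
Lemma full_shift g x y : shift g x y -> cf_full D x -> cf_full D y.
Proof.
move=> xy /fullP fx; apply/fullP => h; have [z xz] := fx (h * g)%g; exists z.
by have := shiftM (shiftV xy) xz; rewrite -mulgA mulgV mulg1.
Qed.

End Heads.

(** * Topology of the space *)

Section Topology.
Context {G : groupType} (D : cf_seq G).
Local Notation F := (cfF D).
Local Notation C := (cfC D).
Local Notation X := (cf_space D).
Implicit Types (x y z : X) (n m k : nat) (f g : G).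

Let seqG : topologicalType := prod_topology (fun _ : nat => discrete_topology G).

Lemma ambient_nbhs (V : set (cf_ambient (G := G))) (a : cf_ambient (G := G)) :
  nbhs a V -> exists k, forall b : cf_ambient (G := G),
    b.1 = a.1 -> (forall i, (i < k)%N -> b.2 i = a.2 i) -> V b.
Proof.
case: a => a1 a2 [[A B] /= [nA nB] AB].
have A1 : A a1 by exact: nbhs_singleton nA.
pose W k := [set b : prod_topology (fun _ : nat => discrete_topology G) |
  forall i, (i < k)%N -> b i = a2 i].
have FW : Filter (filter_from [set: nat] W).
  apply: filter_from_filter; first by exists 0%N.
  move=> i j _ _; exists (maxn i j) => // b Wb; split=> l lt; apply: Wb.
    by rewrite leq_max lt.
  by rewrite leq_max lt orbT.
(* The filter of agreement on longer and longer prefixes converges coordinatewise, hence in the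
   product topology; so some prefix condition already implies [B]. *)
have : filter_from [set: nat] W --> a2.
  apply/cvg_sup => i; apply/cvg_image.
    by apply/seteqP; split=> // u _; exists (fun=> u).
  move=> U nU; have Ua : U (a2 i) by exact: nbhs_singleton nU.
  exists (@^~ i @^-1` U); first by exists i.+1 => // b Wb; rewrite /= Wb.
  by rewrite image_preimage//; apply/seteqP; split=> // u _; exists (fun=> u).
move=> /(_ _ nB) [k _ WB]; exists k => -[b1 b2] /= -> b2E.
by apply: (AB (a1, b2)); split=> //=; apply: WB.
Qed.

Lemma nbhs_ambient k (a : cf_ambient (G := G)) :
  nbhs a [set b : cf_ambient (G := G) |
    b.1 = a.1 /\ forall i, (i < k)%N -> b.2 i = a.2 i].
Proof.
case: a => a1 a2.
exists ([set a1], [set b : seqG | forall i, (i < k)%N -> b i = a2 i]); last first.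
  by move=> [b1 b2] /= [].
split=> /=; first exact: discrete_set1.
elim: k => [|k IH].
  by rewrite (_ : [set _ | _] = setT); [exact: filterT|exact/seteqP].
have nk : nbhs (a2 : seqG) ((@^~ k) @^-1` [set a2 k]).
  by apply: (@proj_continuous nat (fun=> discrete_topology G) k a2);
    exact: discrete_set1.
rewrite (_ : [set b : seqG | _] =
    [set b : seqG | forall i, (i < k)%N -> b i = a2 i] `&` (@^~ k) @^-1` [set a2 k]).
  exact: filterI.
apply/seteqP; split=> [b b1|b [b1 b2] i].
  by split=> [i ik|]; apply: b1 => //; exact: ltnW.
by rewrite ltnS leq_eqVlt => /orP[/eqP ->//|/b1].
Qed.

Lemma iter_step_eq k (a b : cf_ambient (G := G)) :
  b.1 = a.1 -> (forall i, (i < k)%N -> b.2 i = a.2 i) ->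
  (iter k (@cf_step G) b).1 = (iter k (@cf_step G) a).1.
Proof.
elim: k => [//|k IH] e1 e2 /=; rewrite !iter_cf_step2 !addn0 e2// IH// => i ik.
by apply: e2; exact: ltnW.
Qed.

Lemma cf_openE (U : set X) : open U <-> forall n, open (@cf_in G D n @^-1` U).
Proof. exact: sigT_openP. Qed.

(** The inductive limit topology is handled through this criterion. Fixing [f_n] and the next [k]
    coordinates in X_n is the same as fixing the head at level [n + k], so prefix neighbourhoods and
    cylinders correspond. *)
Lemma openP (U : set X) :
  open U <-> forall x, U x -> exists2 n, lev n x & cyl n (hd n x) `<=` U.
Proof.
split=> [/cf_openE oU x Ux|H].
  have [n /cf_inP[a ax]] := lev_exists x.
  have [V oV VU] := oU n.
  have /ambient_nbhs[k Vk] : nbhs (set_val a) V.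
    apply: open_nbhs_nbhs; split=> //.
    by have : (set_val @^-1` V) a by rewrite VU /= ax.
  exists (n + k)%N; first by rewrite -ax; apply: (lev_leq (leq_addr k n)); exact: lev_in.
  move=> y xy; have [] := @hd_leq _ _ n (n + k) x y (leq_addr _ _).
  - by rewrite -ax; exact: lev_in.
  - exact: xy.
  move=> /cf_inP[b by_] hb; rewrite -by_.
  have hyx i : (i <= k)%N -> hd (n + i) y = hd (n + i) x.
    move=> ik; have [] // := @hd_leq _ _ (n + i) (n + k) x y _ _ xy.
      by rewrite leq_add2l.
    by rewrite -ax; apply: (lev_leq (leq_addr i n)); exact: lev_in.
  suff : (set_val @^-1` V) b by rewrite VU.
  apply: Vk; first by rewrite -!hd_in ax by_.
  move=> i ik; have := hyx _ ik; rewrite addnS -by_ -ax !hdS by_ ax hyx ?(ltnW ik)//.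
  exact: mulgI.
apply/cf_openE => n; rewrite openE => a /= Ua.
have [m lm mU] := H _ Ua.
have {lm}mU : cyl (n + m) (hd (n + m) (cf_in a)) `<=` U.
  by apply: subset_trans mU; apply: cyl_sub => //; rewrite leq_addl.
have := @initial_continuous _ _ (set_val : cf_level D n -> _) a.
move=> /(_ _ (nbhs_ambient m (set_val a))).
move=> N; apply: (@filterS _ (nbhs a) _ _ _ _ N) => b [b1 b2]; apply: mU.
split; last by rewrite !hd_iter; exact: iter_step_eq.
by apply: (@lev_leq _ D n); [exact: leq_addr|exact: lev_in].
Qed.

Lemma cyl_open n f : open (cyl n f : set X).
Proof.
by apply/openP => x xf; exists n => [|y]; [exact: cyl_lev xf|case: xf => _ <-].
Qed.

Lemma cyl_closed n f : closed (cyl n f : set X).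
Proof.
rewrite -openC; apply/openP => x nx; have [m lx] := lev_exists x.
exists (maxn n m); first exact: lev_leq (leq_maxr _ _) _ lx.
move=> y [ly hy] yf; apply: nx; case: (yf) => [lyn <-].
apply: (@hd_leq _ _ n (maxn n m)) => //; first exact: leq_maxl.
by split=> //; exact: lev_leq (leq_maxr _ _) _ lx.
Qed.

Lemma lev_open n : open (lev n : set X).
Proof. by rewrite levE; apply: bigcup_open => f _; exact: cyl_open. Qed.

Lemma ultra_bigcup (T : Type) (U : set_system T) (I : eqType) (s : seq I) (A : I -> set T) :
  UltraFilter U -> U (\bigcup_(i in [set` s]) A i) -> exists2 i, i \in s & U (A i).
Proof.
move=> UU; elim: s => [|i s IH] Us.
  by have [x []] := filter_ex Us.
have [UA|UA] := in_ultra_setVsetC (A i) UU; first by exists i; rewrite ?mem_head.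
have [|j js Uj] := IH; last by exists j; rewrite ?in_cons ?js ?orbT.
apply: filterS (filterI Us UA) => t [[j /=]]; rewrite in_cons.
by case/orP => [/eqP -> //|js Aj _]; exists j.
Qed.

(** An ultrafilter containing a cylinder selects one of its finitely many subcylinders at each
    level; the selected heads are those of a point, to which it converges. *)
Lemma cyl_compact n f : compact (cyl n f : set X).
Proof.
rewrite compact_ultra => U UU Uf.
have Un k : exists g, U (cyl (n + k) g).
  elim: k => [|k [g Ug]]; first by exists f; rewrite addn0.
  have gF : g \in F (n + k)%N by have [x /cyl_F] := filter_ex Ug.
  move: Ug; rewrite (cylS gF) => /ultra_bigcup[c cC Uc].
  by exists (g * c)%g; rewrite addnS.
have {Un} [h Uh] := choice Un.
(* Two selected cylinders meet, both being members of the filter, so the selected heads are those of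
   one point at both levels; this makes consecutive choices compatible. *)
have hFC k m : (k <= m)%N ->
    exists x, [/\ lev (n + k) x, hd (n + k) x = h k & hd (n + m) x = h m].
  by move=> km; have [x [[? ?] [? ?]]] := filter_ex (filterI (Uh k) (Uh m)); exists x.
have [||x lx hx] := @lev_make _ D n (fun m => h (m - n)%N).
- by rewrite subnn; have [x []] := hFC _ _ (leqnn 0); rewrite addn0 => lx <- _; exact: hdF.
- move=> m nm; have [x []] := hFC _ _ (leqnSn (m - n)).
  rewrite addnS subnKC// => lx <-; rewrite -subSn// => <-.
  exact: (hdC lx).
have xh k : cyl (n + k) (h k) x.
  split; first exact: lev_leq (leq_addr _ _) _ lx.
  by rewrite hx ?leq_addr// addKn.
exists x; split.
  have [y [y1 y2]] := filter_ex (filterI Uf (Uh 0%N)); rewrite addn0 in y2.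
  by rewrite (cyl_eq y1 y2); have := xh 0%N; rewrite addn0.
move=> V; rewrite nbhsE => -[W [oW Wx] WV].
have [m lm mW] := (openP W).1 oW _ Wx.
apply: filterS (Uh m); apply: subset_trans WV; apply: subset_trans mW.
rewrite -(proj2 (xh m)); apply: cyl_sub => //; exact: leq_addl.
Qed.

Lemma lev_compact n : compact (lev n : set X).
Proof.
rewrite levE -bigsetU_fset_set; last exact: finite_fset.
by apply: bigsetU_compact => f _; exact: cyl_compact.
Qed.

Lemma compact_lev (K : set X) : compact K -> exists n, K `<=` lev n.
Proof.
rewrite compact_cover => /(_ nat setT (@lev G D)) [].
- by move=> n _; exact: lev_open.
- by rewrite /cover lev_cover.
move=> s _ Ks; exists (\max_(i <- s) i)%N => x /Ks [i /= is_ lx].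
by apply: lev_leq lx; exact: (@leq_bigmax_seq _ _ _ id).
Qed.

Lemma cf_zero_dimensional : zero_dimensional X.
Proof.
move=> x y xy.
have [n lx] := lev_exists x; have [m ly] := lev_exists y.
have {}lx := lev_leq (leq_maxl n m) lx; have {}ly := lev_leq (leq_maxr n m) ly.
suff [k [nk hk]] : exists k, (maxn n m <= k)%N /\ hd k x <> hd k y.
  exists (cyl k (hd k x)); split.
  - by split; [exact: cyl_open|exact: cyl_closed].
  - by split=> //; exact: lev_leq lx.
  - by move=> [_ /esym].
apply: contrapT => /forallNP H; move/eqP: xy; apply; apply: (lev_ext lx ly) => k nk.
by apply: contrapT => hk; apply: (H k).
Qed.

Lemma cf_hausdorff : hausdorff_space X.
Proof.
move=> x y cxy; apply: contrapT => /eqP xy.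
have [U [[oU cU] Ux Uy]] := cf_zero_dimensional xy.
have [||z [Uz]] := cxy U (~` U); last by [].
- exact: open_nbhs_nbhs.
- by apply: open_nbhs_nbhs; split=> //; rewrite openC.
Qed.

(** An isolated point would be an entire cylinder, but [#C_n > 1] cuts each cylinder into at least
    two nonempty ones. *)
Lemma cf_perfect : perfect_set [set: X].
Proof.
apply/perfectTP => x /openP/(_ x erefl)[n lx sub].
have hxF := hdF lx.
have : exists c c', [/\ c \in C n.+1, c' \in C n.+1 & c != c'].
  have := cf_card_C D n; rewrite cardfE => /card_gt1P[c [c' [_ _ cc']]].
  by exists (val c), (val c'); split; rewrite ?fsvalP ?val_eqE.
move=> [c [c' [cC c'C cc']]].
have [y yc] := cyl_nonempty (FC_mul hxF cC).
have [z zc] := cyl_nonempty (FC_mul hxF c'C).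
have yx : y = x by apply: sub; rewrite cylS//; exists c.
have zx : z = x by apply: sub; rewrite cylS//; exists c'.
move/eqP: cc'; apply; apply: (@mulgI _ (hd n x)).
by apply: (@cyl_eq _ D n.+1 _ _ x); [rewrite -{2}yx|rewrite -{2}zx].
Qed.

Lemma cf_locally_compact : locally_compact [set: X].
Proof.
move=> x _; have [n lx] := lev_exists x.
exists (cyl n (hd n x)).
  apply: (@filterS _ (nbhs x) _ (cyl n (hd n x))); first by move=> y yx _.
  by apply: open_nbhs_nbhs; split; [exact: cyl_open|].
by split; [exact: cyl_compact|exact: cyl_closed].
Qed.

Lemma cyl_shift n x f : lev n x -> f \in F n ->
  exists2 y, shift (f * (hd n x)^-1)%g x y & cyl n f y.
Proof.
move=> lx fF; have E : (f * (hd n x)^-1 * hd n x)%g = f by rewrite -mulgA mulVg mulg1.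
have [|y ly hy] := shift_ex lx (g := (f * (hd n x)^-1)%g); first by rewrite E.
by exists y; [exists n|split=> //; rewrite hy// E].
Qed.

Lemma tail_dense x : dense [set y : X | cf_tail D x y].
Proof.
move=> O [y Oy] /openP/(_ y Oy)[n ly sub].
have [m lx] := lev_exists x.
have {}lx := lev_leq (leq_maxr n m) lx; have ly' := lev_leq (leq_maxl n m) ly.
have [z xz zy] := cyl_shift lx (hdF ly').
exists z; split; last by apply/tailP; eexists; exact: xz.
by apply: sub; apply: (cyl_sub (leq_maxl n m) ly).
Qed.

Lemma tail_countable_equivalence : countable [set: G] -> countable_equivalence (cf_tail D).
Proof.
move=> cG; split.
- by move=> x; apply/tailP; exists 1%g; exact: shift1.
- by move=> x y /tailP[g xy]; apply/tailP; exists g^-1%g; exact: shiftV.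
- move=> x y z /tailP[g xy] /tailP[h yz]; apply/tailP; exists (h * g)%g.
  exact: shiftM xy yz.
(* The class of [x] is contained in the image of [G] under the partial translations applied to
   [x]. *)
- move=> x; pose s g := xget x [set y | shift g x y].
  apply: (@sub_countable _ _ _ (s @` setT)); last exact: sub_countable (card_image_le _ _) cG.
  apply: subset_card_le => y /tailP[g xy]; exists g => //.
  by rewrite /s; case: xgetP => [z _ /(shift_fun xy)//|/(_ y)].
Qed.

End Topology.

(** * A complete ultrametric *)

(** An alias that receives the metric structure without disturbing the topology of [cf_space D];
    [nbhs_metric] shows that the two topologies coincide. *)
Definition cf_metric (R : realType) (G : groupType) (D : cf_seq G) : Type :=
  cf_space D.

Section Metric.
Context {R : realType} {G : groupType} (D : cf_seq G).
Local Notation X := (cf_space D).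
Implicit Types (x y z : X) (n m k : nat) (f g : G).

Lemma lev_existsb x : exists n, `[< lev n x >].
Proof. by have [n lx] := lev_exists x; exists n; exact/asboolP. Qed.

Definition minlev x : nat := ex_minn (lev_existsb x).

Lemma minlevP n x : lev n x <-> (minlev x <= n)%N.
Proof.
rewrite /minlev; case: ex_minnP => m /asboolP lx mP; split=> [nx|mn].
  by apply: mP; exact/asboolP.
exact: lev_leq lx.
Qed.

(* The sets agree k x are the balls around x of the metric below.  Recording the
   least level minlev x as well makes Cauchy sequences stay in one compact X_n. *)
Definition agree k x : set X := cyl (minlev x + k) (hd (minlev x + k) x).

Lemma minlev_lev k x : lev (minlev x + k) x.
Proof. by apply/minlevP; exact: leq_addr. Qed.

(** By [hd_leq], membership in a lower level passes between points of a common cylinder, in both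
    directions. This makes [agree k] symmetric and transitive. *)
Lemma agree_minlev k x y : agree k x y -> minlev y = minlev x.
Proof.
move=> xy; apply/eqP; rewrite eqn_leq; apply/andP; split.
  apply/minlevP; apply: cyl_lev; apply: (@hd_leq _ D (minlev x) _ x y _ _ xy).
    exact: leq_addr.
  by apply/minlevP.
have [ly hy] := xy.
have yle : (minlev y <= minlev x + k)%N by exact/minlevP.
apply/minlevP; apply: cyl_lev; apply: (@hd_leq _ D (minlev y) _ y x yle).
  exact/minlevP.
by split; [exact: minlev_lev|].
Qed.

Lemma agree_refl k x : agree k x x.
Proof. by split => //; exact: minlev_lev. Qed.

Lemma agree_sym k x y : agree k x y -> agree k y x.
Proof.
move=> xy; have e := agree_minlev xy; rewrite /agree e; case: xy => _ hy.
by split; [exact: minlev_lev|].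
Qed.

Lemma agree_trans k x y z : agree k x y -> agree k y z -> agree k x z.
Proof.
move=> xy; rewrite /agree (agree_minlev xy) => -[lz hz].
by split=> //; rewrite hz; case: xy.
Qed.

Lemma agree_leq k l x y : (k <= l)%N -> agree l x y -> agree k x y.
Proof. by move=> kl; apply: cyl_sub; [rewrite leq_add2l|exact: minlev_lev]. Qed.

Lemma agree_eq x y : (forall k, agree k x y) -> x = y.
Proof.
move=> xy; have [ly _] := xy 0%N; rewrite addn0 in ly.
apply: (lev_ext _ ly); first exact/minlevP.
by move=> m /subnKC <-; have [_ ->] := xy (m - minlev x)%N.
Qed.

Definition cf_dist x y : R :=
  if pselect (exists k, ~~ `[< agree k x y >]) is left H then (ex_minn H).+1%:R^-1
  else 0.

Lemma cf_distP k x y : (cf_dist x y < k.+1%:R^-1) <-> agree k x y.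
Proof.
rewrite /cf_dist; case: pselect => [H|H].
  case: ex_minnP => m /asboolP nm mP; rewrite ltf_pV2 ?posrE ?ltr0n// ltr_nat ltnS.
  split=> [km|ak]; last by rewrite ltnNge; apply/negP => mk; apply: nm; exact: agree_leq ak.
  by apply: contrapT => /asboolPn/mP; rewrite leqNgt km.
split=> [_|_]; last by rewrite invr_gt0 ltr0n.
by apply: contrapT => /asboolPn nk; apply: H; exists k.
Qed.

Lemma cf_dist_cases x y : (forall k, agree k x y) /\ cf_dist x y = 0 \/
  exists2 k, ~ agree k x y & cf_dist x y = k.+1%:R^-1.
Proof.
rewrite /cf_dist; case: pselect => [H|H].
  by right; case: ex_minnP => m /asboolP nm _; exists m.
by left; split=> // k; apply: contrapT => /asboolPn nk; apply: H; exists k.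
Qed.

Lemma cf_dist_ge0 x y : 0 <= cf_dist x y.
Proof. by have [[_ ->]|[k _ ->]] := cf_dist_cases x y; rewrite ?invr_ge0. Qed.

Lemma cf_distxx x : cf_dist x x = 0.
Proof.
by have [[_ ->//]|[k []]] := cf_dist_cases x x; exact: agree_refl.
Qed.

Lemma cf_dist_eq0 x y : cf_dist x y = 0 -> x = y.
Proof.
have [[/agree_eq//]|[k _ ->]] := cf_dist_cases x y.
by move/eqP; rewrite invr_eq0 pnatr_eq0.
Qed.

Lemma cf_dist_le x y x' y' :
  (forall k, agree k x' y' -> agree k x y) -> cf_dist x y <= cf_dist x' y'.
Proof.
move=> H; have [[_ ->]|[k nk ->]] := cf_dist_cases x y; first exact: cf_dist_ge0.
by rewrite leNgt; apply/negP => /cf_distP/H.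
Qed.

Lemma cf_dist_sym x y : cf_dist x y = cf_dist y x.
Proof.
by apply/eqP; rewrite eq_le !cf_dist_le// => k; exact: agree_sym.
Qed.

Lemma cf_dist_triangle y x z : cf_dist x z <= cf_dist x y + cf_dist y z.
Proof.
have [[_ ->]|[k nk ->]] := cf_dist_cases x z.
  by rewrite addr_ge0 ?cf_dist_ge0.
have [xy|xy] := ltP (cf_dist x y) k.+1%:R^-1; last first.
  by rewrite (le_trans xy)// lerDl cf_dist_ge0.
have [yz|yz] := ltP (cf_dist y z) k.+1%:R^-1; last first.
  by rewrite (le_trans yz)// lerDr cf_dist_ge0.
by exfalso; apply: nk; apply: (@agree_trans k x y); exact/cf_distP.
Qed.

HB.instance Definition _ := Choice.copy (cf_metric R D) (cf_space D).
HB.instance Definition _ := isMetric.Build R (cf_metric R D)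
  cf_distxx cf_dist_eq0 cf_dist_sym cf_dist_triangle.
HB.instance Definition _ := isPointed.Build (cf_metric R D) (cf_base D).

Lemma ball_agree k x : ball (x : cf_metric R D) (k.+1%:R^-1 : R) = agree k x.
Proof.
rewrite ballEmdist; apply/seteqP; split=> y /=; by move/cf_distP.
Qed.

Lemma nbhs_metric x : nbhs (x : cf_metric R D) = nbhs (x : X).
Proof.
apply/seteqP; split=> U /=.
  move=> /nbhs_ballP[e /= e0 eU].
  have [k ke] : exists k, k.+1%:R^-1 < e.
    exists (Num.truncn e^-1); rewrite invf_plt ?posrE ?ltr0n//.
    exact: truncnS_gt.
  have : open_nbhs x (agree k x) by split; [exact: cyl_open|exact: agree_refl].
  move/open_nbhs_nbhs; apply: filterS => y; rewrite -ball_agree => yk.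
  by apply: eU; apply: le_ball yk; exact: ltW.
rewrite nbhsE => -[W [oW Wx] WU].
have [n lx nW] := (openP W).1 oW _ Wx.
apply/nbhs_ballP; exists n.+1%:R^-1; first by rewrite /= invr_gt0 ltr0n.
rewrite ball_agree; apply: subset_trans WU; apply: subset_trans nW.
by apply: cyl_sub => //; exact: leq_addl.
Qed.

Lemma open_metric (U : set X) : open (U : set (cf_metric R D)) <-> open U.
Proof.
rewrite !openE; split=> oU x Ux; have := oU x Ux; rewrite /interior /=.
  by rewrite nbhs_metric.
by rewrite nbhs_metric.
Qed.

Lemma cf_metric_complete (U : set_system (cf_metric R D)) :
  ProperFilter U -> cauchy U -> cvg U.
Proof.
move=> PU cU.
(* The radius is 1, written so that [ball_agree] at [k = 0] applies: a Cauchy filter contains a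
   single cylinder, which is compact. *)
have /cauchyP/(_ (1%:R^-1 : R)) := cU; rewrite invr_gt0 ltr0n => /(_ isT)[x].
rewrite ball_agree => Ux.
apply: (@compact_cauchy_cvg (cf_metric R D) (agree 0 x) _ PU cU Ux).
have := @cyl_compact _ D (minlev x + 0) (hd (minlev x + 0) x).
rewrite /compact /cluster => H F PF /(H F PF)[p [pA pF]]; exists p; split=> //.
by move=> A B FA; rewrite nbhs_metric; exact: pF.
Qed.

HB.instance Definition _ := Uniform_isComplete.Build (cf_metric R D) cf_metric_complete.

Lemma cf_metrizable : metrizable R X.
Proof.
exists (cf_metric R D), id, id; split=> // x U; first by rewrite nbhs_metric.
by rewrite -[X in X U]/(nbhs (x : X)) -nbhs_metric.
Qed.

Lemma cf_standard_borel : countable [set: G] -> standard_borel R X.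
Proof.
move=> cG; exists (cf_metric R D), id; split=> //.
- exact: metric_hausdorff.
(* One point in each nonempty cylinder gives a countable dense set. *)
- pose s (p : nat * G) := xget (cf_base D) (cyl p.1 p.2).
  have cNG : countable [set: nat * G].
    by rewrite -setXTT; exact: countableX.
  exists (s @` setT).
    exact: sub_countable (card_image_le _ _) cNG.
  move=> O [x Ox] /open_metric/openP/(_ x Ox)[n lx sub].
  exists (s (n, hd n x)); split; last by exists (n, hd n x).
  by apply: sub; rewrite /s; case: xgetP => [y _ yP|/(_ x)[]].
- by exists id.
- move=> A; rewrite image_id.
  have -> : @open (cf_metric R D) = @open X.
    by apply/seteqP; split=> U; move/open_metric.
  by [].
Qed.

End Metric.

(** * Invariant measures and cylinders *)

Section CylinderMeasurability.
Context {R : realType} {G : groupType} (D : cf_seq G).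
Local Notation F := (cfF D).
Local Notation C := (cfC D).
Local Notation X := (cf_space D).
Implicit Types (x y z : X) (n m k N : nat) (f g : G).

Lemma open_cf_measurable (U : set X) : open U -> measurable U.
Proof. by move=> oU; exact: sub_sigma_algebra. Qed.

Lemma cyl_measurable n f : measurable (cyl n f : set X).
Proof. by apply: open_cf_measurable; exact: cyl_open. Qed.

Lemma lev_measurable n : measurable (lev n : set X).
Proof. by apply: open_cf_measurable; exact: lev_open. Qed.

(* The cylinders of level at least N, which still form a base. *)
Definition cyls N : set (set X) :=
  [set A | A = set0 \/ exists n f, (N <= n)%N /\ A = cyl n f].

(** Two cylinders that meet are nested, the one of higher level inside the other. *)
Lemma cyls_setI N : setI_closed (cyls N).
Proof.
move=> A B [->|[n [f [Nn ->]]]]; first by rewrite set0I; left.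
move=> [->|[m [g [Nm ->]]]]; first by rewrite setI0; left.
have [->|/eqP/set0P[x [xf xg]]] := pselect ((cyl n f : set X) `&` cyl m g = set0).
  by left.
wlog nm : n m f g Nn Nm xf xg / (n <= m)%N.
  move=> H; have [nm|/ltnW mn] := leqP n m; first exact: (H n m).
  by rewrite setIC; exact: (H m n).
right; exists m, g; split=> //; apply: setIidr.
by case: (xf) (xg) => lx <- [_ <-]; exact: cyl_sub.
Qed.

(** Sorting the cylinders inside [U] by level gives a countable union of finite unions, whence
    measurability. *)
Lemma open_cylsE N (U : set X) : open U ->
  U = \bigcup_n \bigcup_(f in [set f | f \in F (N + n) /\ cyl (N + n) f `<=` U])
        cyl (N + n) f.
Proof.
move=> oU; apply/seteqP; split=> [x Ux|x [n _ [f [_ fU]] /fU//]].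
have [n lx sub] := (openP U).1 oU x Ux.
have lNx : lev (N + n) x by apply: lev_leq lx; exact: leq_addl.
exists n => //; exists (hd (N + n) x) => //; split; first exact: hdF.
by apply: subset_trans sub; apply: cyl_sub => //; exact: leq_addl.
Qed.

Lemma measurable_cyls N : @measurable _ X = <<s cyls N >>.
Proof.
apply/seteqP; split=> A.
  apply: smallest_sub; first exact: smallest_sigma_algebra.
  move=> U oU; rewrite (open_cylsE N oU).
  apply: (@bigcupT_measurable _ (g_sigma_algebraType (cyls N))) => n.
  apply: (@fin_bigcup_measurable _ (g_sigma_algebraType (cyls N))).
    by apply: sub_finite_set (finite_fset (F (N + n))) => f [].
  move=> f _; apply: sub_sigma_algebra; right; exists (N + n)%N, f; split=> //.
  exact: leq_addr.
apply: smallest_sub; first exact: sigma_algebra_measurable.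
by move=> B [->|[n [f [_ ->]]]]; [exact: measurable0|exact: cyl_measurable].
Qed.

(** The bound [N] allows a map acting on X_n to be tested only on levels at least [n], where it
    multiplies heads by a constant. *)
Lemma cyl_measurable_fun N d (T : measurableType d) (E : set T) (S : T -> X) :
  measurable E ->
  (forall n f, (N <= n)%N -> f \in F n -> measurable (E `&` S @^-1` cyl n f)) ->
  measurable_fun E S.
Proof.
move=> mE mS; apply: (measurability (cyls N)); first exact: measurable_cyls.
move=> _ [_ [->|[n [f [Nn ->]]]] <-]; first by rewrite preimage_set0 setI0.
have [fF|fF] := boolP (f \in F n); first exact: mS.
rewrite [X in _ `&` X](_ : _ = set0) ?setI0//.
by apply/seteqP; split=> // t /cyl_F; rewrite (negbTE fF).
Qed.

(** The defaults, [(0, 0)] for a code of nothing and [1%g] for a position past the end, keep every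
    term a cylinder with head in F_n. *)
Definition cyl_enum N k : set X :=
  let p := odflt (0, 0)%N (choice.unpickle k) in
  cyl (N + p.1) (nth 1%g (F (N + p.1)) p.2).

Lemma cyl_enum_cover N : \bigcup_k cyl_enum N k = [set: X].
Proof.
apply/seteqP; split=> // x _; have [n lx] := lev_exists x.
have {}lx : lev (N + n) x by apply: lev_leq lx; exact: leq_addl.
exists (choice.pickle (n, index (hd (N + n) x) (F (N + n)))) => //.
by rewrite /cyl_enum choice.pickleK /= nth_index//; exact: hdF.
Qed.

Lemma mem_enum N k : exists n f, [/\ (N <= n)%N, f \in F n & cyl_enum N k = cyl n f].
Proof.
rewrite /cyl_enum; set p := odflt _ _.
exists (N + p.1)%N, (nth 1%g (F (N + p.1)) p.2); split=> //; first exact: leq_addr.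
have [lt|ge] := ltnP p.2 (size (F (N + p.1))); first exact: mem_nth.
by rewrite nth_default//; exact: cf_1F.
Qed.

(** The cylinders of level at least [N] are a generating family stable under intersection, and
    countably many of them, of finite measure, cover the space. *)
Lemma cyl_measure_unique N (mu nu : {measure set X -> \bar R}) :
  (forall n f, (N <= n)%N -> f \in F n -> mu (cyl n f) = nu (cyl n f)) ->
  (forall n f, (N <= n)%N -> f \in F n -> (mu (cyl n f) < +oo)%E) ->
  forall A, measurable A -> mu A = nu A.
Proof.
move=> munu mufin; apply: (measure_unique (cyls N) (cyl_enum N)).
- exact: measurable_cyls.
- exact: cyls_setI.
- by move=> k; have [n [f [Nn _ ->]]] := mem_enum N k; right; exists n, f.
- exact: cyl_enum_cover.
- move=> A [->|[n [f [Nn ->]]]]; first by rewrite !measure0.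
  have [fF|fF] := boolP (f \in F n); first exact: munu.
  rewrite (_ : cyl n f = set0) ?measure0//.
  by apply/seteqP; split=> // x /cyl_F; rewrite (negbTE fF).
- by move=> k; have [n [f [Nn fF ->]]] := mem_enum N k; exact: mufin.
Qed.

Lemma fset_bigcup_measure d (T : measurableType d) (I : choiceType)
    (mu : {measure set T -> \bar R}) (s : {fset I}) (A : I -> set T) (v : R) :
  trivIset [set` s] A -> (forall i, i \in s -> measurable (A i)) ->
  (forall i, i \in s -> mu (A i) = v%:E) ->
  mu (\bigcup_(i in [set` s]) A i) = ((#|` s|)%:R * v)%:E.
Proof.
move=> tA mA vA; rewrite measure_fin_bigcup//.
rewrite fsbig_finite//= set_fsetK big_seq (eq_bigr (fun=> v%:E))// -big_seq.
by rewrite sumEFin big_const_seq count_predT iter_addr addr0 mulr_natl.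
Qed.

End CylinderMeasurability.

(** * Partial translations between cylinders and invariance of measures *)

Section PartialShift.
Context {R : realType} {G : groupType} (D : cf_seq G).
Local Notation F := (cfF D).
Local Notation C := (cfC D).
Local Notation X := (cf_space D).
Implicit Types (x y z : X) (n m k N : nat) (f g h : G).

(* The partial translation of cyl n f onto cyl n f', extended by the identity. *)
Definition move n f f' x : X :=
  if x \in (cyl n f : set X) then xget x [set y | shift (f' * f^-1)%g x y] else x.

Lemma moveP n f f' x : f' \in F n -> cyl n f x ->
  shift (f' * f^-1)%g x (move n f f' x).
Proof.
move=> f'F xf; rewrite /move mem_set//; case: xgetP => [y _//|/=].
case: xf => lx <-; have [y xy _] := cyl_shift lx f'F.
by move=> /(_ y).
Qed.

Lemma move_hd n f f' x : f' \in F n -> cyl n f x ->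
  lev n (move n f f' x) /\
  forall m, (n <= m)%N -> hd m (move n f f' x) = (f' * f^-1 * hd m x)%g.
Proof.
move=> f'F xf; have [lx hx] := xf.
have [|y ly hy] := shift_ex lx (g := (f' * f^-1)%g); first by rewrite hx -mulgA mulVg mulg1.
suff -> : move n f f' x = y by [].
by apply: (shift_fun (moveP f'F xf)); exists n.
Qed.

Lemma move_cyl n f f' x : f' \in F n -> cyl n f x -> cyl n f' (move n f f' x).
Proof.
move=> f'F xf; have [ly hy] := move_hd f'F xf; split=> //.
by rewrite hy// (proj2 xf) -mulgA mulVg mulg1.
Qed.

Lemma moveK n f f' x : f' \in F n -> cyl n f x -> move n f' f (move n f f' x) = x.
Proof.
move=> f'F xf; have fF := cyl_F xf.
have /shiftV := moveP f'F xf; rewrite invgM invgK => s.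
exact: (shift_fun (moveP fF (move_cyl f'F xf)) s).
Qed.

Lemma move_cylE n m f f' h x : (n <= m)%N -> f' \in F n -> cyl n f x ->
  cyl m h (move n f f' x) <-> cyl m (f * f'^-1 * h)%g x.
Proof.
move=> nm f'F xf; have [ly hy] := move_hd f'F xf.
have lmx := lev_leq nm (cyl_lev xf); have lmy := lev_leq nm ly.
split=> [[_]|[_]]; rewrite ?hy// => E; split=> //.
  by rewrite -E -!mulgA mulKg mulVKg.
by rewrite hy// E -!mulgA mulKg mulVKg.
Qed.

Lemma move_out n f f' x : ~ cyl n f x -> move n f f' x = x.
Proof. by move=> nxf; rewrite /move memNset. Qed.

Lemma move_measurable n f f' : f' \in F n ->
  measurable_fun [set: X] (move n f f').
Proof.
move=> f'F; apply: (@cyl_measurable_fun _ _ n) => // m h nm hF; rewrite setTI.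
rewrite (_ : _ @^-1` _ = (cyl n f `&` cyl m (f * f'^-1 * h)%g) `|` (cyl m h `\` cyl n f)).
  apply: measurableU; first by apply: measurableI; exact: cyl_measurable.
  by apply: measurableD; exact: cyl_measurable.
apply/seteqP; split=> x /=.
  have [xf|xf] := pselect (cyl n f x).
    by move=> /(move_cylE _ nm f'F xf); left.
  by rewrite move_out//; right.
by move=> [[xf /(move_cylE _ nm f'F xf)//]|[xh xf]]; rewrite move_out.
Qed.

Lemma shift_moveP g x y : shift g x y -> exists n f f',
  [/\ f \in F n, f' \in F n, cyl n f x & y = move n f f' x].
Proof.
move=> [n [lx ly hy]]; exists n, (hd n x), (hd n y); split=> //; try exact: hdF.
have E : (hd n y * (hd n x)^-1)%g = g by rewrite hy// mulgK.
have := moveP (hdF ly) (cyl_hd lx); rewrite E => s.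
by apply: shift_fun s; exists n.
Qed.

Section Invariance.
Variable mu : {measure set X -> \bar R}.

Definition cyl_uniform : Prop := forall n f f', f \in F n -> f' \in F n ->
  mu (cyl n f) = mu (cyl n f').

Hypothesis mu_fin : forall n f, (mu (cyl n f) < +oo)%E.

(** Both sides are finite measures in [A], so cylinders of level [m >= n] suffice. One inside
    [cyl n f'] pulls back to a cylinder of the same level inside [cyl n f], of equal mass by
    uniformity. *)
Lemma move_measure n f f' (A : set X) : cyl_uniform -> f \in F n -> f' \in F n ->
  measurable A -> mu (cyl n f `&` move n f f' @^-1` A) = mu (cyl n f' `&` A).
Proof.
move=> muU fF f'F mA.
have mf := move_measurable f f'F.
pose mu1 : {measure set X -> \bar R} :=
  measure_function_pushforward__canonical__measure_function_Measure
    (mrestr mu (cyl_measurable n f)) mf.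
pose mu2 : {measure set X -> \bar R} := mrestr mu (cyl_measurable n f').
suff : mu1 A = mu2 A by rewrite /mu1 /mu2 /= /pushforward /mrestr setIC => ->; rewrite setIC.
apply: (@cyl_measure_unique _ _ _ n mu1 mu2) => //; last first.
  move=> m h nm hF; rewrite /mu1 /= /pushforward /mrestr.
  apply: le_lt_trans (mu_fin n f); apply: le_measure; rewrite ?inE.
  - apply: measurableI; last exact: cyl_measurable.
    by rewrite -[X in measurable X]setTI; apply: (mf) => //; exact: cyl_measurable.
  - exact: cyl_measurable.
  - exact: subIsetr.
move=> m h nm hF; rewrite /mu1 /mu2 /= /pushforward /mrestr.
have -> : move n f f' @^-1` cyl m h `&` cyl n f = cyl m (f * f'^-1 * h)%g `&` cyl n f.
  by apply/seteqP; split=> x [xh xf]; split=> //; exact/(move_cylE _ nm f'F xf).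
have [E|/eqP/set0P[y [yh yf']]] := pselect ((cyl m h : set X) `&` cyl n f' = set0).
  rewrite E measure0 (_ : _ `&` _ = set0) ?measure0//.
  apply/seteqP; split=> // x [xm xf].
  suff : (cyl m h `&` cyl n f') (move n f f' x) by rewrite E.
  by split; [exact/(move_cylE _ nm f'F xf)|exact: move_cyl].
have subC a b (z : X) : cyl m a z -> cyl n b z ->
      (cyl m a : set X) `&` cyl n b = cyl m a.
  move=> za zb; apply: setIidl; case: (za) (zb) => lz <- [ly <-].
  exact: cyl_sub.
have yf := move_cyl fF yf'.
have ym : cyl m (f * f'^-1 * h)%g (move n f' f y).
  by apply/(move_cylE _ nm fF yf'); rewrite -!mulgA mulKg mulVKg.
rewrite (subC _ _ _ ym yf) (subC _ _ _ yh yf'); apply: muU => //.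
exact: cyl_F ym.
Qed.

(** Two points of X_n are equal exactly when they share a cylinder at every level from [n] on, which
    turns the coincidence set into a countable intersection of finite unions. *)
Lemma measurable_eq_move (S : X -> X) n f f' : f' \in F n ->
  measurable_fun [set: X] S -> measurable [set x | cyl n f x /\ S x = move n f f' x].
Proof.
move=> f'F mS; have mf := move_measurable f f'F.
rewrite (_ : [set _ | _] = cyl n f `&` \bigcap_m \bigcup_(h in [set` F (n + m)])
    (S @^-1` cyl (n + m) h `&` move n f f' @^-1` cyl (n + m) h)).
  apply: measurableI; first exact: cyl_measurable.
  apply: bigcapT_measurable => m; apply: fin_bigcup_measurable => // h _.
  by apply: measurableI; rewrite -[X in measurable X]setTI; [apply: mS|apply: mf] => //;
    exact: cyl_measurable.
apply/seteqP; split=> [x [xf E]|x [xf H]].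
  have lx : lev n (move n f f' x) by exact: cyl_lev (move_cyl f'F xf).
  split=> // m _; have lm := lev_leq (leq_addr m n) lx.
  by exists (hd (n + m) (move n f f' x)); [exact: hdF|split; rewrite /= ?E].
split=> //; have lx : lev n (move n f f' x) by exact: cyl_lev (move_cyl f'F xf).
have lS : lev n (S x).
  by have [h _ []] := H 0%N I; rewrite addn0 => -[].
apply: (lev_ext lS lx) => m /subnKC <-.
by have [h _ [[_ ->] [_ ->]]] := H (m - n)%N I.
Qed.

Lemma uniform_invariant : cyl_uniform -> relation_invariant (cf_tail D) mu.
Proof.
move=> muU S [bS mS mSi] SR A mA.
(* A code stands for a level and two positions in the finite set F of that level, so there are
   countably many candidate moves even when the tail classes are infinite. *)
pose fs (k : nat) : nat * (nat * nat) := odflt (0, (0, 0))%N (choice.unpickle k).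
pose lv k := (fs k).1.
pose f1 k := nth 1%g (F (lv k)) (fs k).2.1; pose f2 k := nth 1%g (F (lv k)) (fs k).2.2.
have nthF n i : nth 1%g (F n) i \in F n.
  have [lt|ge] := ltnP i (size (F n)); first exact: mem_nth.
  by rewrite nth_default//; exact: cf_1F.
pose P k := [set x | cyl (lv k) (f1 k) x /\ S x = move (lv k) (f1 k) (f2 k) x].
have mP k : measurable (P k) by apply: measurable_eq_move => //; exact: nthF.
have Pcover : \bigcup_k P k = setT.
  apply/seteqP; split=> // x _; have /tailP[g] := SR x.
  move=> /shift_moveP[n [f [f' [fF f'F xf E]]]].
  exists (choice.pickle (n, (index f (F n), index f' (F n)))) => //.
  by rewrite /P /= /f1 /f2 /lv /fs choice.pickleK /= !nth_index.
have mD k : measurable (seqDU P k) by exact: seqDU_measurable.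
have tD := trivIset_seqDU P.
have Dcover : \bigcup_k seqDU P k = setT by rewrite -seqDU_bigcup_eq.
have inj : injective S by exact: bij_inj.
have E1 : S @^-1` A = \bigcup_k (seqDU P k `&` S @^-1` A).
  by rewrite -setI_bigcupl Dcover setTI.
(* Bijectivity of [S] makes the images of the disjoint pieces a partition of the space too, so the
   two sides can be compared piece by piece. *)
have E2 : A = \bigcup_k (S @` seqDU P k `&` A).
  rewrite -setI_bigcupl -image_bigcup Dcover.
  suff -> : range S = setT by rewrite setTI.
  have [Si _ SiK] := bS; apply/seteqP; split=> // y _; exists (Si y) => //; exact: SiK.
have mSA : measurable (S @^-1` A) by rewrite -[X in measurable X]setTI; exact: mS.
have mB k : measurable (S @` seqDU P k `&` A).
  by apply: measurableI => //; apply: mSi.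
have tB : trivIset setT (fun k => S @` seqDU P k `&` A).
  move=> i j _ _ [_ [[[x Dx <-] Ay] [[x' Dx' /inj E] _]]].
  by apply: tD => //; exists x; split=> //; rewrite -E.
have mDA k : measurable (seqDU P k `&` S @^-1` A) by exact: measurableI.
have tDA : trivIset setT (fun k => seqDU P k `&` S @^-1` A) by exact: trivIset_setIr.
rewrite E1 [in RHS]E2 (measure_bigcup mu _ _ (fun k _ => mDA k) tDA).
rewrite (measure_bigcup mu _ _ (fun k _ => mB k) tB).
apply: eq_eseriesr => k _.
have sub : S @` seqDU P k `&` A `<=` cyl (lv k) (f2 k).
  move=> _ [[x Dx <-] _]; have [xf ->] := subset_seqDU Dx.
  by apply: move_cyl => //; exact: nthF.
rewrite -(setIidr sub) -(move_measure (f := f1 k) muU)//; [|exact: nthF..].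
congr (mu _); apply/seteqP; split=> [x [Dx Ax]|x [xf [[y Dy E] Ax]]].
  have [xf E] := subset_seqDU Dx; split=> //=; rewrite -E; split=> //.
  by exists x.
have [yf E'] := subset_seqDU Dy.
have xy : x = y.
  rewrite -(moveK (f' := f2 k) (nthF _ _) xf) -E E'.
  exact: moveK (nthF _ _) yf.
by rewrite xy; split=> //=; rewrite E xy in Ax *.
Qed.

(** Two cases suffice, as [move n f' f] is already the identity outside [cyl n f']. *)
Definition swap n f f' x : X :=
  if x \in (cyl n f : set X) then move n f f' x else move n f' f x.

Lemma swapK n f f' : f \in F n -> f' \in F n -> involutive (swap n f f').
Proof.
move=> fF f'F x; have [->|ff'] := eqVneq f f'.
  have mid y : move n f' f' y = y.
    have [yf|yf] := pselect (cyl n f' y); last exact: move_out.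
    apply: (shift_fun (moveP f'F yf)); rewrite mulgV; exact: shift1.
  by rewrite /swap !mid; case: ifP; rewrite ?mid; case: ifP; rewrite ?mid.
have dj y : cyl n f' y -> y \notin (cyl n f : set X).
  move=> yf'; apply/negP => /set_mem yf; move/eqP: ff'; apply.
  exact: cyl_eq yf yf'.
rewrite /swap; have [/set_mem xf|nxf] := boolP (x \in _).
  by rewrite (negbTE (dj _ (move_cyl f'F xf))) moveK.
have [xf'|xf'] := pselect (cyl n f' x).
  by rewrite mem_set ?moveK//; exact: move_cyl.
by rewrite move_out// (negbTE nxf) move_out.
Qed.

Lemma swap_pre n f f' (A : set X) :
  swap n f f' @^-1` A = (cyl n f `&` move n f f' @^-1` A) `|`
                        (move n f' f @^-1` A `\` cyl n f).
Proof.
apply/seteqP; split=> x; rewrite /swap /=.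
  case: ifPn => [/set_mem xf|/negP xf] Ax; [by left|right; split=> //].
  by move=> xf'; apply: xf; exact/mem_set.
by case: ifPn => [/set_mem xf [[]//|[]//]|/negP xf [[/mem_set]//|[]//]].
Qed.

Lemma swap_borel n f f' : f \in F n -> f' \in F n ->
  borel_transformation (swap n f f' : X -> X).
Proof.
move=> fF f'F; have sK := swapK fF f'F.
have ms : measurable_fun [set: X] (swap n f f').
  move=> _ A mA; rewrite setTI swap_pre; apply: measurableU.
    apply: measurableI; first exact: cyl_measurable.
    by rewrite -[X in measurable X]setTI; apply: move_measurable.
  apply: measurableD; last exact: cyl_measurable.
  by rewrite -[X in measurable X]setTI; apply: move_measurable.
split=> //; first by exists (swap n f f').
move=> A mA; rewrite (_ : _ @` _ = swap n f f' @^-1` A).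
  by rewrite -[X in measurable X]setTI; exact: ms.
apply/seteqP; split=> [_ [x Ax <-]|x Ax]; first by rewrite /= sK.
by exists (swap n f f' x).
Qed.

Lemma invariant_uniform : relation_invariant (cf_tail D) mu -> cyl_uniform.
Proof.
move=> inv n f f' fF f'F.
have -> : cyl n f = swap n f f' @^-1` (cyl n f').
  have sK := swapK fF f'F; have H x : cyl n f x -> cyl n f' (swap n f f' x).
    by move=> xf; rewrite /swap mem_set//; exact: move_cyl.
  apply/seteqP; split=> [x|x /= xf']; first exact: H.
  have [xf|nxf] := pselect (cyl n f x) => //.
  have := xf'; rewrite /swap memNset// => m.
  have [yf'|yf'] := pselect (cyl n f' x).
    have := move_cyl fF yf' => /cyl_eq/(_ m) ff'.
    by move: nxf; rewrite ff'.
  by move: m; rewrite move_out.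
apply: inv; first exact: swap_borel.
  move=> x; apply/tailP; rewrite /swap; case: ifPn => [/set_mem xf|_].
    by eexists; exact: moveP.
  have [xf'|xf'] := pselect (cyl n f' x); first by eexists; exact: moveP.
  by exists 1%g; rewrite move_out//; exact: shift1.
exact: cyl_measurable.
Qed.

End Invariance.
End PartialShift.

(** * Masses of cylinders, uniqueness and ergodicity *)

Section Mass.
Context {R : realType} {G : groupType} (D : cf_seq G).
Local Notation F := (cfF D).
Local Notation C := (cfC D).
Local Notation X := (cf_space D).
Implicit Types (x y z : X) (n m k N : nat) (f g : G) (c : R).
Implicit Types mu nu : {measure set X -> \bar R}.

Definition cprod n : nat := \prod_(1 <= i < n.+1) #|` C i|.

Lemma cprodS n : cprod n.+1 = (cprod n * #|` C n.+1|)%N.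
Proof. by rewrite /cprod big_nat_recr. Qed.

Lemma cprod0 : cprod 0 = 1%N.
Proof. by rewrite /cprod big_nil. Qed.

Lemma cprod_gt0 n : (0 < cprod n)%N.
Proof. by elim: n => [|n IH]; rewrite ?cprod0// cprodS muln_gt0 IH C_gt0. Qed.

Definition cyl_mass mu c := forall n f, f \in F n ->
  mu (cyl n f) = (c / (cprod n)%:R)%:E.

Lemma cyl_mass_lty mu c n f : cyl_mass mu c -> (mu (cyl n f) < +oo)%E.
Proof.
move=> cm; have [fF|fF] := boolP (f \in F n); first by rewrite cm// ltry.
rewrite (_ : cyl n f = set0) ?measure0//.
by apply/seteqP; split=> // x /cyl_F; rewrite (negbTE fF).
Qed.

Lemma F_bigcup_measure mu c n (s : {fset G}) : cyl_mass mu c -> (s `<=` F n)%fset ->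
  mu (\bigcup_(f in [set` s]) cyl n f) = (#|` s|%:R * (c / (cprod n)%:R))%:E.
Proof.
move=> cm sF; apply: fset_bigcup_measure; first exact: cyl_trivIset.
  by move=> f _; exact: cyl_measurable.
by move=> f fs; apply: cm; exact: (fsubsetP sF).
Qed.

Lemma lev_mass mu c n : cyl_mass mu c ->
  mu (lev n) = (#|` F n|%:R * (c / (cprod n)%:R))%:E.
Proof. by move=> cm; rewrite levE; exact: F_bigcup_measure. Qed.

(** Since F_0 = {1}, the constant is the mass of X_0; passing from level [n] to [n.+1] cuts a
    cylinder into [#C_{n+1}] pieces of equal mass. *)
Lemma uniform_mass mu : (forall n f, (mu (cyl n f) < +oo)%E) -> cyl_uniform mu ->
  cyl_mass mu (fine (mu (cyl 0 1%g))).
Proof.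
move=> mufin muU; have fE n f : mu (cyl n f) = (fine (mu (cyl n f)))%:E.
  by rewrite fineK// ge0_fin_numE.
have F1 n : 1%g \in F n by exact: cf_1F.
suff H n : mu (cyl n 1%g) = (fine (mu (cyl 0 1%g)) / (cprod n)%:R)%:E.
  by move=> n f fF; rewrite (muU n f 1%g).
elim: n => [|n IH]; first by rewrite cprod0 divr1 -fE.
have := IH; rewrite (cylS (F1 n)).
rewrite (@fset_bigcup_measure R _ X _ mu _ _ (fine (mu (cyl n.+1 1%g)))).
- move=> [E]; rewrite fE; congr (_%:E).
  rewrite cprodS natrM invfM mulrA -E mulrAC mulfV ?mul1r//.
  by rewrite pnatr_eq0 -lt0n C_gt0.
- by move=> c c' _ _ [x [/cyl_eq xc /xc /mulgI]].
- by move=> c _; exact: cyl_measurable.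
- by move=> c cC; rewrite -fE; apply: muU => //; exact: FC_mul.
Qed.

Lemma mass_uniform mu c : cyl_mass mu c -> cyl_uniform mu.
Proof. by move=> cm n f f' fF f'F; rewrite !cm. Qed.

Lemma cf_measure_fin mu n f : cf_measure mu -> (mu (cyl n f) < +oo)%E.
Proof. by case=> _ _ _; apply; exact: cyl_compact. Qed.

Lemma mass0 mu : cyl_mass mu 0 -> mu [set: X] = 0%E.
Proof.
move=> cm; rewrite (@cyl_measure_unique R G D 0 mu mzero)//.
- by move=> n f _ fF; rewrite cm// mul0r.
- by move=> n f _ fF; exact: cyl_mass_lty cm.
Qed.

Lemma cf_measure_mass mu : cf_measure mu -> exists2 c, 0 < c & cyl_mass mu c.
Proof.
move=> cmu; have mufin n f : (mu (cyl n f) < +oo)%E by exact: cf_measure_fin.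
have [inv mu0 _ _] := cmu.
have cm := uniform_mass mufin (invariant_uniform inv).
exists (fine (mu (cyl 0 1%g))) => //.
rewrite lt_neqAle fine_ge0// andbT; apply/eqP => E.
by apply: mu0; apply: mass0; rewrite E.
Qed.

Lemma mass_cf_measure mu c : 0 < c -> cyl_mass mu c -> cf_measure mu.
Proof.
move=> c0 cm; split.
- apply: uniform_invariant; last exact: mass_uniform cm.
  by move=> n f; exact: cyl_mass_lty cm.
- move=> mu0; have : (mu (cyl 0 1%g) <= mu [set: X])%E.
    by apply: le_measure; rewrite ?inE//; exact: cyl_measurable.
  rewrite mu0 cm ?cf_1F// lee_fin leNgt divr_gt0// ltr0n; exact: cprod_gt0.
- exists (@lev G D); first by rewrite lev_cover.
  by move=> n; split; [exact: lev_measurable|rewrite (lev_mass n cm) ltry].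
- move=> K cK; have [n Kn] := compact_lev cK.
  apply: (@le_lt_trans _ _ (mu (lev n))); last by rewrite (lev_mass n cm) ltry.
  apply: le_measure; rewrite ?inE//; last exact: lev_measurable.
  have cl : closed K by apply: compact_closed => //; exact: cf_hausdorff.
  by rewrite -[K]setCK; apply: measurableC; apply: open_cf_measurable; rewrite openC.
Qed.

Lemma mass_unique mu nu c : cyl_mass mu c -> cyl_mass nu c ->
  forall A, measurable A -> mu A = nu A.
Proof.
move=> cm cn; apply: (@cyl_measure_unique R G D 0).
- by move=> n f _ fF; rewrite cm// cn.
- by move=> n f _ _; exact: cyl_mass_lty cm.
Qed.

Lemma cf_measure_unique mu nu : cf_measure mu -> cf_measure nu ->
  exists2 c : R, 0 < c & forall A, measurable A -> nu A = (c%:E * mu A)%E.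
Proof.
move=> /cf_measure_mass[a a0 am] /cf_measure_mass[b b0 bm].
have ba : 0 < b / a by exact: divr_gt0.
exists (b / a) => // A mA.
pose r : {nonneg R} := NngNum (ltW ba).
have -> : ((b / a)%:E * mu A = mscale r mu A)%E by [].
apply: (mass_unique bm) => // n f fF; rewrite /= /mscale /= am// -EFinM.
by congr (_%:E); rewrite mulrA divfK// gt_eqF.
Qed.

Lemma tail_ergodic mu (E : set X) : cf_measure mu -> measurable E ->
  invariant_set (cf_tail D) E -> mu E = 0%E \/ mu (~` E) = 0%E.
Proof.
move=> cmu mE invE; have [inv mu0 _ cK] := cmu.
have [E0|E0] := pselect (mu E = 0%E); first by left.
right; pose nu : {measure set X -> \bar R} := mrestr mu mE.
have le_nu A : measurable A -> (nu A <= mu A)%E.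
  by move=> mA; rewrite /nu /= /mrestr; apply: le_measure; rewrite ?inE//;
    exact: measurableI.
have cnu : cf_measure nu.
  split.
  - move=> S bS SR A mA; rewrite /nu /= /mrestr.
    have mAE : measurable (A `&` E) by exact: measurableI.
    rewrite -(inv S bS SR _ mAE); congr (mu _).
    apply/seteqP; split=> x [Ax Ex]; split=> //; first exact: invE (SR x) Ex.
    apply: invE Ex; have /tailP[g s] := SR x; apply/tailP; exists g^-1%g.
    exact: shiftV.
  - by rewrite /nu /= /mrestr setTI.
  - exists (@lev G D); first by rewrite lev_cover.
    move=> n; split; first exact: lev_measurable.
    apply: (@le_lt_trans _ _ (mu (lev n))); first by apply: le_nu; exact: lev_measurable.
    by apply: cK; exact: lev_compact.
  - move=> K kK; have cl : closed K by apply: compact_closed => //; exact: cf_hausdorff.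
    apply: (@le_lt_trans _ _ (mu K)); last exact: cK.
    apply: le_nu; rewrite -[K]setCK; apply: measurableC; apply: open_cf_measurable.
    by rewrite openC.
have [c c0 H] := cf_measure_unique cmu cnu.
(* The restriction of [mu] to [E] vanishes on the complement of [E], yet it is a positive multiple
   of [mu]. *)
have := H (~` E) (measurableC mE); rewrite /nu /= /mrestr setICl measure0.
by move/esym/eqP; rewrite mule_eq0 eqe gt_eqF//= => /eqP.
Qed.

End Mass.

(** * Existence of the measure: cutting and stacking *)

Section CuttingStacking.
Context {R : realType} {G : groupType} (D : cf_seq G).
Local Notation F := (cfF D).
Local Notation C := (cfC D).
Local Notation X := (cf_space D).
Implicit Types (x y z : X) (n m k N : nat) (f g : G) (t : R).

Lemma nth_allpairs (S T U : Type) (h : S -> T -> U) (x0 : S) (y0 : T) (z0 : U)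
    (s : seq S) (r : seq T) i j : (i < size s)%N -> (j < size r)%N ->
  nth z0 [seq h a b | a <- s, b <- r] (i * size r + j) = h (nth x0 s i) (nth y0 r j).
Proof.
elim: s i => [//|a s IH] [|i] /=; rewrite nth_cat size_map => si rj.
  by rewrite mul0n add0n rj (nth_map y0).
by rewrite mulSn -addnA ltnNge leq_addr /= addKn IH.
Qed.

(* An enumeration of F_n, chosen so that the elements of F_n C_{n+1} come first
   in F_{n+1}, grouped by their factor in F_n: this is the order in which the
   levels of the n-th tower are laid out on the half-line. *)
Fixpoint tower n : seq G :=
  if n is m.+1 then
    let s := [seq (f * c)%g | f <- tower m, c <- (C m.+1 : seq G)] in
    s ++ [seq f <- (F m.+1 : seq G) | f \notin s]
  else [:: 1%g].

Lemma towerP n : uniq (tower n) /\ tower n =i F n.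
Proof.
elim: n => [|n [uT mT]] /=.
  by split=> // f; rewrite cf_F0 !inE.
have sF f : f \in [seq (f * c)%g | f <- tower n, c <- (C n.+1 : seq G)] -> f \in F n.+1.
  by move=> /allpairsP[[a c] /= [aF cC ->]]; apply: FC_mul; rewrite // -mT.
split.
  rewrite cat_uniq filter_uniq ?fset_uniq// andbT; apply/andP; split.
    apply: allpairs_uniq; rewrite ?fset_uniq// => -[a c] [a' c'] /=.
    move=> /allpairsP[[u v] /= [uF vC [-> ->]]] /allpairsP[[u' v'] /= [u'F v'C [-> ->]]].
    rewrite !mT in uF u'F.
  by move=> e; have [-> ->] := FC_inj uF u'F vC v'C e.
  by apply/hasPn => f; rewrite mem_filter => /andP[].
move=> f; rewrite mem_cat mem_filter.
by case: (boolP (f \in _)) => [/sF ->|].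
Qed.

Lemma size_tower n : size (tower n) = #|` F n|.
Proof.
have [uT mT] := towerP n; apply/eqP.
by rewrite eq_sym -(uniq_size_uniq uT mT) fset_uniq.
Qed.

Lemma nth_towerS n i j : (i < #|` F n|)%N -> (j < #|` C n.+1|)%N ->
  nth 1%g (tower n.+1) (i * #|` C n.+1| + j) =
  (nth 1%g (tower n) i * nth 1%g (C n.+1) j)%g.
Proof.
rewrite -size_tower => iF jC /=; rewrite nth_cat size_allpairs.
have -> : (i * #|` C n.+1| + j < size (tower n) * size (C n.+1))%N.
  apply: (@leq_trans (i.+1 * #|` C n.+1|)); first by rewrite mulSn addnC ltn_add2r.
  by rewrite leq_mul2r iF orbT.
exact: (@nth_allpairs _ _ _ (fun a b => a * b)%g).
Qed.

(** The half-line is divided into intervals of length [1 / (#C_1 ... #C_n)]; this is the number of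
    the one containing [t], and the first [height n] of them form the n-th tower. *)
Definition slot n t : nat := Num.truncn (t * (cprod D n)%:R).

Definition height n : nat := #|` F n|.

(** Each interval of level [n] is subdivided into [#C_{n+1}] equal ones, so Euclidean division
    recovers the coarser index. *)
Lemma slotS n t : 0 <= t -> (slot n.+1 t %/ #|` C n.+1|)%N = slot n t.
Proof.
move=> t0; rewrite /slot cprodS; set b := #|` C n.+1|; set B := cprod D n.
have b0 : (0 < b)%N by exact: C_gt0.
have tB0 : 0 <= t * B%:R by rewrite mulr_ge0.
have tBb0 : 0 <= t * (B * b)%N%:R by rewrite mulr_ge0.
apply/esym/truncn_def.
have /andP[l r] := truncn_itv tBb0.
move: (Num.truncn _) l r => i l r; rewrite natrM mulrA in l r.
have lb : ((i %/ b)%N * b)%N%:R <= t * B%:R * b%:R.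
  by apply: le_trans l; rewrite ler_nat leq_trunc_div.
have rb : t * B%:R * b%:R < ((i %/ b).+1 * b)%N%:R.
  by apply: lt_le_trans r _; rewrite ler_nat ltn_ceil.
rewrite natrM ler_pM2r ?ltr0n// in lb; rewrite natrM ltr_pM2r ?ltr0n// in rb.
by rewrite lb rb.
Qed.

(** The subdivided n-th tower occupies the initial segment of the next one, so a point below the top
    of one tower stays below the top of all later ones. *)
Lemma slot_height n m t : 0 <= t -> (n <= m)%N ->
  (slot n t < height n)%N -> (slot m t < height m)%N.
Proof.
move=> t0 /subnKC <-; elim: (m - n)%N => [|k IH]; rewrite ?addn0// addnS => /IH.
set p := (n + k)%N => sp; rewrite (divn_eq (slot p.+1 t) #|` C p.+1|) slotS//.
apply: (@leq_trans (height p * #|` C p.+1|)).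
  apply: (@leq_trans ((slot p t).+1 * #|` C p.+1|)).
    by rewrite mulSn addnC ltn_add2r ltn_mod C_gt0.
  by rewrite leq_mul2r sp orbT.
by rewrite /height -!size_tower /= size_cat size_allpairs leq_addr.
Qed.

Lemma tower_slotS n t : 0 <= t -> (slot n t < height n)%N ->
  nth 1%g (tower n.+1) (slot n.+1 t) =
  (nth 1%g (tower n) (slot n t) * nth 1%g (C n.+1) (slot n.+1 t %% #|` C n.+1|))%g.
Proof.
move=> t0 sn; rewrite {1}(divn_eq (slot n.+1 t) #|` C n.+1|) slotS// nth_towerS//.
by rewrite ltn_mod C_gt0.
Qed.

Lemma tower_mem n i : (i < height n)%N -> nth 1%g (tower n) i \in F n.
Proof. by move=> iF; rewrite -(proj2 (towerP n)) mem_nth// size_tower. Qed.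

Lemma point_ex n t : 0 <= t -> (slot n t < height n)%N ->
  exists2 x : X, lev n x & forall m, (n <= m)%N -> hd m x = nth 1%g (tower m) (slot m t).
Proof.
move=> t0 sn; apply: (@lev_make _ D n (fun m => nth 1%g (tower m) (slot m t))).
  exact: tower_mem.
move=> m nm; rewrite tower_slotS//; last exact: slot_height sn.
by rewrite mulKg mem_nth// ltn_mod C_gt0.
Qed.

Definition stack_dom : set R := [set t | 0 <= t /\ exists n, (slot n t < height n)%N].

(** The conjunct [stack_dom t] empties the set for [t] outside the domain, negative [t] included, so
    the default [cf_base D] is taken there. *)
Definition stack_map t : X := xget (cf_base D) [set x | stack_dom t /\ exists n,
  [/\ (slot n t < height n)%N, lev n x &
    forall m, (n <= m)%N -> hd m x = nth 1%g (tower m) (slot m t)]].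

Lemma stack_mapP t : stack_dom t -> exists n,
  [/\ (slot n t < height n)%N, lev n (stack_map t) &
    forall m, (n <= m)%N -> hd m (stack_map t) = nth 1%g (tower m) (slot m t)].
Proof.
move=> Tt; rewrite /stack_map; case: xgetP => [x _ []//|H].
have [t0 [n sn]] := Tt; have [x lx hx] := point_ex t0 sn.
by case: (H x); split=> //; exists n.
Qed.

Lemma stack_map_out t : ~ stack_dom t -> stack_map t = cf_base D.
Proof. by move=> nT; rewrite /stack_map; case: xgetP => [x _ []|]. Qed.

Lemma stack_preimage n f : f \in F n ->
  stack_dom `&` stack_map @^-1` cyl n f =
  [set t | 0 <= t /\ slot n t = index f (tower n)].
Proof.
have [uT mT] := towerP n => fF; have fT : f \in tower n by rewrite mT.
apply/seteqP; split=> [t [Tt [lx hx]]|t [t0 sn]].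
  have [t0 _] := Tt; split=> //.
  suff [sn E] : (slot n t < height n)%N /\ hd n (stack_map t) = nth 1%g (tower n) (slot n t).
    by rewrite -hx E index_uniq// size_tower.
  have [m [sm lm hm]] := stack_mapP Tt.
  have [mn|/ltnW/subnKC nm] := leqP m n; first by split; [exact: slot_height sm|exact: hm].
  (* Here [t] is only known to lie below the top of a later tower. The descent to level [n] goes one
     level at a time: the head at [p.+1] factors uniquely, its position in the tower is quotient and
     remainder, and the quotient is the slot at [p]. *)
  have {hm} := hm m (leqnn m); rewrite -nm in sm *.
  elim: (m - n)%N sm => [|k IH]; rewrite ?addn0// addnS; set p := (n + k)%N => sp hp.
  have lp : lev p (stack_map t) by exact: lev_leq (leq_addr _ _) _ lx.
  have [uTp mTp] := towerP p; have [uTp1 _] := towerP p.+1.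
  pose c := ((hd p (stack_map t))^-1 * hd p.+1 (stack_map t))%g.
  have cC : c \in C p.+1 by exact: (hdC lp).
  have hF := hdF lp.
  have hT : hd p (stack_map t) \in tower p by rewrite mTp.
  have iF : (index (hd p (stack_map t)) (tower p) < #|` F p|)%N.
    by rewrite -size_tower index_mem.
  have jC : (index c (C p.+1) < #|` C p.+1|)%N by rewrite index_mem.
  have E : slot p.+1 t =
      (index (hd p (stack_map t)) (tower p) * #|` C p.+1| + index c (C p.+1))%N.
    apply/eqP; rewrite -(nth_uniq 1%g _ _ uTp1) ?size_tower//; last first.
      rewrite -size_tower /= size_cat size_allpairs; apply: ltn_addr.
      apply: (@leq_trans ((index (hd p (stack_map t)) (tower p)).+1 * #|` C p.+1|)).
        by rewrite mulSn addnC ltn_add2r.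
      by rewrite leq_mul2r size_tower iF orbT.
    by rewrite -hp nth_towerS// !nth_index// /c mulVKg.
  have E' : slot p t = index (hd p (stack_map t)) (tower p).
    by rewrite -slotS// E divnMDl ?C_gt0// divn_small// addn0.
  by apply: IH; rewrite E'// nth_index.
have sh : (slot n t < height n)%N by rewrite sn /height -size_tower index_mem.
have Tt : stack_dom t by split=> //; exists n.
split=> //; have [m [sm lm hm]] := stack_mapP Tt.
have [x lx hx] := point_ex t0 sh.
rewrite /preimage /=; suff <- : x = stack_map t by split=> //; rewrite hx// sn nth_index.
apply: (@lev_ext _ D (maxn n m)).
- exact: lev_leq (leq_maxl _ _) _ lx.
- exact: lev_leq (leq_maxr _ _) _ lm.
- by move=> k; rewrite geq_max => /andP[nk mk]; rewrite hx// hm.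
Qed.

Lemma slot_itv n i : [set t | 0 <= t /\ slot n t = i] =
  [set` `[(i%:R / (cprod D n)%:R : R), (i.+1%:R / (cprod D n)%:R)[%R].
Proof.
have B0 : 0 < (cprod D n)%:R :> R by rewrite ltr0n cprod_gt0.
apply/seteqP; split=> t /=; rewrite in_itv /= ler_pdivrMr// ltr_pdivlMr//.
  by move=> [t0 <-]; apply: truncn_itv; rewrite mulr_ge0// ltW.
move=> it; split; last exact: truncn_def.
have /andP[l _] := it; have : 0 <= t * (cprod D n)%:R by apply: le_trans l.
by rewrite pmulr_lge0.
Qed.

Lemma stack_dom_measurable : measurable stack_dom.
Proof.
have -> : stack_dom = \bigcup_n \bigcup_(i in `I_(height n)) [set t | 0 <= t /\ slot n t = i].
  apply/seteqP; split=> [t [t0 [n sn]]|t [n _ [i /= iH [t0 E]]]].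
    by exists n => //; exists (slot n t).
  by split=> //; exists n; rewrite E.
apply: bigcupT_measurable => n; apply: fin_bigcup_measurable => // i _.
by rewrite slot_itv; exact: measurable_itv.
Qed.

Lemma stack_map_measurable : measurable_fun [set: R] stack_map.
Proof.
have mT := stack_dom_measurable.
apply: (@cyl_measurable_fun _ _ 0) => // n f _ fF; rewrite setTI.
have -> : stack_map @^-1` cyl n f = (stack_dom `&` stack_map @^-1` cyl n f) `|`
    (~` stack_dom `&` [set t | cyl n f (cf_base D)]).
  apply/seteqP; split=> t /=.
    have [Tt|nT] := pselect (stack_dom t); first by left.
    by rewrite stack_map_out//; right.
  by move=> [[]//|[nT]]; rewrite stack_map_out.
apply: measurableU; first by rewrite stack_preimage// slot_itv; exact: measurable_itv.
apply: measurableI; first exact: measurableC.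
have [b|b] := pselect (cyl n f (cf_base D)).
  by rewrite (_ : [set _ | _] = setT)//; apply/seteqP; split.
by rewrite (_ : [set _ | _] = set0)//; apply/seteqP; split.
Qed.

Lemma cf_measure_exists : exists mu : {measure set X -> \bar R}, cf_measure mu.
Proof.
pose mu : {measure set X -> \bar R} :=
  measure_function_pushforward__canonical__measure_function_Measure
    (mrestr (@lebesgue_measure R) stack_dom_measurable) stack_map_measurable.
(* The constant is 1 because X_0 corresponds to the unit interval. *)
exists mu; apply: (@mass_cf_measure _ _ _ _ 1) => // n f fF.
rewrite /mu /= /pushforward /mrestr setIC stack_preimage// slot_itv lebesgue_measure_itv /=.
have B0 : 0 < (cprod D n)%:R :> R by rewrite ltr0n cprod_gt0.
rewrite lte_fin ltr_pM2r ?invr_gt0// ltr_nat ltnSn -EFinB -mulrBl.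
by rewrite -natr1 addrAC subrr add0r.
Qed.

End CuttingStacking.

(** * The action *)

Section Action.
Context {G : groupType} (D : cf_seq G).
Local Notation F := (cfF D).
Local Notation C := (cfC D).
Local Notation X := (cf_space D).
Local Notation T := (cf_action D).
Local Notation Y := (cf_full D).
Implicit Types (x y z : X) (n m k N : nat) (f g h : G).

Lemma countable_enum : countable [set: G] -> exists e : nat -> G, forall g, exists i, e i = g.
Proof.
move=> /countable_injP[r /in2TT rinj].
exists (fun i => xget 1%g [set g | r g = i]) => g; exists (r g).
by apply: rinj; case: xgetP => [h _ //|/(_ g)[]].
Qed.

Lemma domL_leq n m g : (n <= m)%N -> cf_dom_level D n g `<=` cf_dom_level D m g.
Proof.
move=> nm x [a /= aF <-]; have lx := lev_in a.
have [b ba] := cf_inP (lev_leq nm lx).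
exists b => //=; rewrite -hd_in ba; apply: (dom_leq nm lx).
by rewrite hd_in.
Qed.

Lemma domLP n g x : cf_dom_level D n g x <-> lev n x /\ (g * hd n x)%g \in F n.
Proof.
split=> [[a /= aF <-]|[/cf_inP[a <-]]]; first by split; [exact: lev_in|rewrite hd_in].
by rewrite hd_in => aF; exists a.
Qed.

Lemma domL_open n g : open (cf_dom_level D n g).
Proof.
apply/openP => x /domLP[lx gF]; exists n => // y [ly hy].
by apply/domLP; split=> //; rewrite hy.
Qed.

Lemma dom_open g : open (cf_dom D g).
Proof. by apply: bigcup_open => n _; exact: domL_open. Qed.

Lemma full_enum (e : nat -> G) : (forall g, exists i, e i = g) ->
  Y = \bigcap_i cf_dom D (e i).
Proof.
move=> eP; apply/seteqP; split=> x H i _; first exact: H.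
by have [j <-] := eP i; exact: H.
Qed.

Lemma full_Gdelta : countable [set: G] -> Gdelta Y.
Proof.
move=> /countable_enum[e eP]; exists (fun i => cf_dom D (e i)).
  by move=> i; exact: dom_open.
exact: full_enum.
Qed.

Lemma full_invariant : invariant_set (cf_tail D) Y.
Proof. by move=> x y /tailP[g s]; exact: full_shift s. Qed.

Lemma actP g x : Y x -> shift g x (T g x).
Proof.
move=> /fullP/(_ g)[y s]; rewrite /cf_action; case: xgetP => [z _ /translateP//|].
by move=> /(_ y); case; exact/translateP.
Qed.

Lemma act_eq g x y : Y x -> shift g x y -> T g x = y.
Proof. by move=> Yx; apply: shift_fun; exact: actP. Qed.

Lemma translate_actP g x y : Y x -> cf_translate D g x y <-> T g x = y.
Proof.
move=> Yx; split=> [/translateP s|<-]; first exact: act_eq.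
by apply/translateP; exact: actP.
Qed.

Lemma act_full g x : Y x -> Y (T g x).
Proof. by move=> Yx; apply: full_shift (Yx); exact: actP. Qed.

Lemma act_is_action : is_action Y T.
Proof.
split.
- exact: act_full.
- by move=> x Yx; apply: act_eq => //; exact: shift1.
- move=> g h x Yx; apply: act_eq => //; apply: shiftM (actP h Yx) _.
  by apply: actP; exact: act_full.
Qed.

Lemma actK g x : Y x -> T g^-1%g (T g x) = x.
Proof. by case: act_is_action => _ T1 TM Yx; rewrite -TM// mulVg T1. Qed.

Lemma actVK g x : Y x -> T g (T g^-1%g x) = x.
Proof. by case: act_is_action => _ T1 TM Yx; rewrite -TM// mulgV T1. Qed.

Lemma act_hd n g x : Y x -> lev n x -> (g * hd n x)%g \in F n ->
  lev n (T g x) /\ forall m, (n <= m)%N -> hd m (T g x) = (g * hd m x)%g.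
Proof.
move=> Yx lx gF; have [y ly hy] := shift_ex lx gF.
suff -> : T g x = y by [].
by apply: act_eq => //; exists n.
Qed.

Lemma act_cyl n g f x : Y x -> cyl n f x -> (g * f)%g \in F n ->
  cyl n (g * f)%g (T g x).
Proof.
move=> Yx [lx <-] gF; have [ly hy] := act_hd Yx lx gF.
by split=> //; rewrite hy.
Qed.

(** Beyond one level [g] acts on the heads, and beyond another the cylinder of [T g x] lies in [U];
    at the larger of the two both hold on a whole cylinder around [x], within the domain of the
    action. *)
Lemma act_local g x (U : set X) : Y x -> open U -> U (T g x) ->
  exists2 n, lev n x & forall z, Y z -> cyl n (hd n x) z -> U (T g z).
Proof.
move=> Yx oU Ux; have [m lm sub] := (openP U).1 oU _ Ux.
have [k [lx ly hy]] := actP g Yx.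
have [km mm] := (leq_maxl k m, leq_maxr k m).
exists (maxn k m); first exact: lev_leq km _ lx.
move=> z Yz zx; apply: sub; apply: (cyl_sub mm lm).
rewrite hy//; apply: act_cyl => //; rewrite -hy//.
exact/hdF/(lev_leq mm).
Qed.

Lemma act_continuous g : {within Y, continuous (T g)}.
Proof.
apply/subspace_continuousP => x Yx U.
rewrite nbhsE => -[W [oW Wx] WU].
have [n lx H] := act_local Yx oW Wx.
apply: (@filterS _ (nbhs x) _ (cyl n (hd n x))).
  by move=> z zx Yz; apply: WU; exact: H.
by apply: open_nbhs_nbhs; split; [exact: cyl_open|].
Qed.

Lemma act_free : free_action Y T.
Proof. by move=> g x Yx E; apply: (@shift_free _ _ g x); rewrite -{2}E; exact: actP. Qed.

Lemma orbit_tail x y : Y x -> Y y -> (exists g, T g x = y) <-> cf_tail D x y.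
Proof.
move=> Yx Yy; split=> [[g <-]|/tailP[g s]].
  by apply/tailP; exists g; exact: actP.
by exists g; exact: act_eq.
Qed.

(** * Products of finite sets and the criterion for an everywhere defined action *)

Lemma fset_mulA : associative (@Defs.fsetM G).
Proof.
move=> A B E; apply/fsetP => x; apply/imfset2P/imfset2P => /=.
  move=> [a aA [_ /imfset2P[b bB [c cE ->]] ->]].
  exists (a * b)%g; last by exists c; rewrite // mulgA.
  by apply/imfset2P; exists a => //; exists b.
move=> [_ /imfset2P[a aA [b bB ->]] [c cE ->]].
exists a => //; exists (b * c)%g; last by rewrite mulgA.
by apply/imfset2P; exists b => //; exists c.
Qed.

Lemma fset_mul1l : left_id [fset 1%g]%fset (@Defs.fsetM G).
Proof.
move=> A; apply/fsetP => x; apply/imfset2P/idP => /= [[_ /fset1P -> [a aA ->]]|xA].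
  by rewrite mul1g.
by exists 1%g; rewrite ?inE//; exists x; rewrite ?mul1g.
Qed.

Lemma fset_mul1r : right_id [fset 1%g]%fset (@Defs.fsetM G).
Proof.
move=> A; apply/fsetP => x; apply/imfset2P/idP => /= [[a aA [_ /fset1P -> ->]]|xA].
  by rewrite mulg1.
by exists x => //; exists 1%g; rewrite ?inE// mulg1.
Qed.

HB.instance Definition _ := Monoid.isLaw.Build {fset G} [fset 1%g]%fset (@Defs.fsetM G)
  fset_mulA fset_mul1l fset_mul1r.

(** This translates the products in (v) and in the limit condition of (vi) into heads of points, so
    that inclusions and cardinalities become statements about cylinders. *)
Lemma cf_prodP n m f : (n <= m)%N ->
  f \in cf_prod D n m <-> exists2 x : X, lev n x & hd m x = f.
Proof.
move=> /subnKC <-; elim: (m - n)%N f => [|k IH] f.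
  rewrite addn0 /cf_prod big_geq// fset_mul1r; split=> [fF|[x lx <-]]; last exact: hdF.
  by have [x [lx hx]] := cyl_nonempty fF; exists x.
rewrite addnS; have -> : cf_prod D n (n + k).+1 =
    Defs.fsetM (cf_prod D n (n + k)) (C (n + k).+1).
  by rewrite /cf_prod big_nat_recr/= ?fset_mulA// ltnS leq_addr.
split=> [/imfset2P[a /= /IH[x lx ha] [c /= cC ->]]|[x lx <-]].
  have lnk := lev_leq (leq_addr k n) lx.
  have [y [ly hy]] := cyl_nonempty (FC_mul (hdF lnk) cC).
  have yx := lev_down (hdF lnk) cC ly hy.
  exists y; last by rewrite hy ha.
  by have [] := @hd_leq _ D n (n + k) x y (leq_addr _ _) lx yx.
apply/imfset2P; exists (hd (n + k) x); first by apply/IH; exists x.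
exists ((hd (n + k) x)^-1 * hd (n + k).+1 x)%g; last by rewrite mulgA mulgV mul1g.
exact: hdC lx (leq_addr _ _).
Qed.

(** The direct implication is compactness: X_n is covered by the increasing open sets X_m^g, hence
    contained in one of them, and heads turn this into the inclusion. *)
Lemma full_setTP : Y = [set: X] <-> forall (g : G) (n : nat), (0 < n)%N ->
  exists2 m, (n < m)%N & (ltrans g (cf_prod D n m) `<=` F m)%fset.
Proof.
split=> [YT g n n0|H].
  have cov : lev n `<=` \bigcup_m cf_dom_level D m g.
    move=> x _; have : Y x by rewrite YT.
    by move=> /(_ g I).
  have := @lev_compact _ D n; rewrite compact_cover.
  move=> /(_ nat setT (fun m => cf_dom_level D m g)) [] //.
    by move=> m _; exact: domL_open.
  move=> s _ sub; pose m := maxn n.+1 (\max_(i <- s) i).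
  have nm : (n < m)%N by exact: leq_maxl.
  exists m => //; apply/fsubsetP => _ /imfsetP[f /= + ->].
  move=> /(cf_prodP _ (ltnW nm))[x lx <-].
  have [i /= is_ ix] := sub _ lx.
  have im : (i <= m)%N.
    by apply: leq_trans (leq_maxr _ _); exact: (@leq_bigmax_seq _ _ _ id).
  by have /domLP[] := domL_leq im ix.
apply/seteqP; split=> // x _ g _; apply/domP; have [n lx] := lev_exists x.
(* The condition is stated for [n > 0] only, so the point is viewed one level up. *)
have {}lx := lev_leq (leqnSn n) lx.
have [m nm /fsubsetP sub] := H g n.+1 isT.
exists m; first exact: lev_leq (ltnW nm) _ lx.
apply: sub; apply/imfsetP; exists (hd m x) => //=.
by apply/cf_prodP; [exact: ltnW|exists x].
Qed.

End Action.

(** * Measure of the domains of the partial translations *)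

Section MeasureOfDomains.
Context {R : realType} {G : groupType} (D : cf_seq G).
Local Notation F := (cfF D).
Local Notation C := (cfC D).
Local Notation X := (cf_space D).
Local Notation Y := (cf_full D).
Implicit Types (x y z : X) (n m k N : nat) (f g h : G).

Hypothesis cG : countable [set: G].
Variables (mu : {measure set X -> \bar R}) (c : R).
Hypotheses (c0 : 0 < c) (cm : cyl_mass mu c).

Let cmu : cf_measure mu := mass_cf_measure c0 cm.

Lemma full_measurable : measurable Y.
Proof.
have [e eP] := countable_enum cG; rewrite (full_enum D eP).
by apply: bigcapT_measurable => i; apply: open_cf_measurable; exact: dom_open.
Qed.

Lemma domL_measurable n g : measurable (cf_dom_level D n g).
Proof. by apply: open_cf_measurable; exact: domL_open. Qed.

Lemma dom_measurable g : measurable (cf_dom D g).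
Proof. by apply: open_cf_measurable; exact: dom_open. Qed.

Lemma massN0 n : 0 < c / (cprod D n)%:R.
Proof. by rewrite divr_gt0// ltr0n cprod_gt0. Qed.

Lemma card_F_gt0 n : (0 < #|` F n|)%N.
Proof. by rewrite cardfs_gt0; apply/fset0Pn; exists 1%g; exact: cf_1F. Qed.

Lemma lev_mass_gt0 n : 0 < #|` F n|%:R * (c / (cprod D n)%:R).
Proof. by rewrite mulr_gt0 ?massN0// ltr0n card_F_gt0. Qed.

Lemma card_cprod n m : (n <= m)%N -> (cf_card D n m * cprod D n = #|` F n| * cprod D m)%N.
Proof.
move=> nm; have -> : cprod D m = (cprod D n * \prod_(n.+1 <= i < m.+1) #|` C i|)%N.
  by rewrite /cprod -big_cat_nat.
by rewrite /cf_card -mulnA [(\prod_(_ <= _ < _) _ * _)%N]mulnC.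
Qed.

Lemma lev_domL_measure n m g : (n <= m)%N ->
  mu (lev n `&` cf_dom_level D m g) =
  (#|` (ltrans g (cf_prod D n m) `&` F m)%fset|%:R * (c / (cprod D m)%:R))%:E.
Proof.
move=> nm; pose s := [fset f in cf_prod D n m | (g * f)%g \in F m]%fset.
(* Left multiplication by [g] is a bijection from [s] onto this intersection, and [s] lists the
   cylinders that make up the set. *)
have -> : #|` (ltrans g (cf_prod D n m) `&` F m)%fset| = #|` s|.
  rewrite -(card_imfset imfset_key (mem s) (@mulgI _ g)); congr (#|` _|).
  apply/fsetP => f; rewrite inE; apply/andP/imfsetP => /=.
    by move=> [/imfsetP[a /= aP ->] gF]; exists a => //; rewrite !inE /= aP.
  move=> [a]; rewrite !inE /= => /andP[aP gF] ->; split=> //.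
  by apply/imfsetP; exists a.
have -> : lev n `&` cf_dom_level D m g = \bigcup_(f in [set` s]) cyl m f.
  apply/seteqP; split=> [x [lx /domLP[lm gF]]|x [f /=]].
    have hP : hd m x \in cf_prod D n m by apply/(cf_prodP _ _ nm); exists x.
    by exists (hd m x) => //; rewrite /mkset !inE /= hP gF.
  rewrite !inE /= => /andP[/(cf_prodP _ _ nm)[y ly hy] gF] [lx hx]; split.
    by have [] := @hd_leq _ D n m y x nm ly; first by split=> //; rewrite hy.
  by apply/domLP; split=> //; rewrite hx.
apply: F_bigcup_measure => //; apply/fsubsetP => f; rewrite !inE /=.
by move=> /andP[/(cf_prodP _ _ nm)[x lx <-] _]; apply: hdF; exact: lev_leq lx.
Qed.

Lemma cvg_lev_domL n g :
  mu (lev n `&` cf_dom_level D m g) @[m --> \oo] --> mu (lev n `&` cf_dom D g).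
Proof.
rewrite /cf_dom setI_bigcupr.
apply: (@nondecreasing_cvg_mu _ _ _ mu (fun m => lev n `&` cf_dom_level D m g)).
- by move=> m; apply: measurableI; [exact: lev_measurable|exact: domL_measurable].
- apply: bigcupT_measurable => m.
  by apply: measurableI; [exact: lev_measurable|exact: domL_measurable].
- by move=> m k mk; apply/subsetPset; apply: setIS; exact: domL_leq.
Qed.

Lemma lev_fin n : mu (lev n) \is a fin_num.
Proof. by rewrite (lev_mass n cm). Qed.

Lemma star_nullP g n :
  ((fun m => (#|` (ltrans g (cf_prod D n m) `&` F m)%fset|)%:R
     / (cf_card D n m)%:R : R) @ \oo --> (1 : R)) <->
  mu (lev n `\` cf_dom D g) = 0%E.
Proof.
set u := (fun m => _ : R).
have lD : measurable (lev n `&` cf_dom D g).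
  by apply: measurableI; [exact: lev_measurable|exact: dom_measurable].
have lc : mu (lev n `&` cf_dom D g) \is a fin_num.
  rewrite ge0_fin_numE//; apply: (@le_lt_trans _ _ (mu (lev n))).
    by apply: le_measure; rewrite ?inE//; exact: lev_measurable.
  by rewrite -ge0_fin_numE// lev_fin.
pose q := fine (mu (lev n `&` cf_dom D g)) / fine (mu (lev n)).
have lev0 : fine (mu (lev n)) != 0 by rewrite (lev_mass n cm)/= gt_eqF// lev_mass_gt0.
have uq : u @ \oo --> q.
  have H : fine (mu (lev n `&` cf_dom_level D m g)) @[m --> \oo] -->
      fine (mu (lev n `&` cf_dom D g)).
    by apply: fine_cvg; rewrite fineK//; exact: cvg_lev_domL.
  have {}H : fine (mu (lev n `&` cf_dom_level D m g)) / fine (mu (lev n)) @[m --> \oo] --> q.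
    exact: cvgM H (cvg_cst _).
  apply: cvg_trans H; apply: near_eq_cvg; near=> m.
  have nm : (n <= m)%N by near: m; exact: nbhs_infty_ge.
  rewrite /= lev_domL_measure// (lev_mass n cm) /= /u.
  (* [cf_card D n m] is the number of cylinders of level [m] in X_n; this identity converts the
     ratio of masses into the ratio of cardinalities. *)
  have E : (cf_card D n m)%:R * (cprod D n)%:R = #|` F n|%:R * (cprod D m)%:R :> R.
    by rewrite -[RHS]natrM -card_cprod// natrM.
  have Bn0 : (cprod D n)%:R != 0 :> R by rewrite pnatr_eq0 -lt0n cprod_gt0.
  have Bm0 : (cprod D m)%:R != 0 :> R by rewrite pnatr_eq0 -lt0n cprod_gt0.
  have Fn0 : #|` F n|%:R != 0 :> R by rewrite pnatr_eq0 -lt0n card_F_gt0.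
  have cn0 : c != 0 by rewrite gt_eqF.
  have -> : (cf_card D n m)%:R = #|` F n|%:R * (cprod D m)%:R / (cprod D n)%:R :> R.
    by rewrite -E mulfK.
  by field; rewrite Bn0 Bm0 Fn0 cn0.
have q1 : q = 1 <-> mu (lev n `\` cf_dom D g) = 0%E.
  have dD : (mu (lev n) = mu (lev n `&` cf_dom D g) + mu (lev n `\` cf_dom D g))%E.
    rewrite addeC -measureDI//; [exact: lev_measurable|exact: dom_measurable].
  rewrite /q; split=> [/(divr1_eq)|E].
    move/eqP; rewrite -subr_eq0 => /eqP H.
    have : (mu (lev n) - mu (lev n `&` cf_dom D g))%E = 0%E.
      by rewrite -(fineK (lev_fin n)) -(fineK lc) -EFinB -opprB H oppr0.
    by rewrite dD addeAC subee// add0e.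
  by rewrite -[in X in X / _](adde0 (mu _)) -E -dD divff.
split=> [u1|/q1 <-//].
by apply/q1; exact: cvg_unique uq u1.
Unshelve. all: by end_near. Qed.

Definition star_cond : Prop := forall (g : G) (n : nat), (0 < n)%N ->
  (fun m => (#|` (ltrans g (cf_prod D n m) `&` F m)%fset|)%:R
    / (cf_card D n m)%:R : R) @ \oo --> (1 : R).

Lemma null_bigcup (A : nat -> set X) : (forall i, measurable (A i)) ->
  (forall i, mu (A i) = 0%E) -> mu (\bigcup_i A i) = 0%E.
Proof.
move=> mA A0; apply/negligibleP; first exact: bigcupT_measurable.
by apply: negligible_bigcup => i; apply/negligibleP; [exact: mA|exact: A0].
Qed.

Lemma null_sub (A B : set X) : measurable A -> measurable B -> A `<=` B ->
  mu B = 0%E -> mu A = 0%E.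
Proof.
move=> mA mB AB B0; apply/eqP; rewrite eq_le measure_ge0 andbT -B0.
by apply: le_measure; rewrite ?inE.
Qed.

Lemma lev_dom_null g : (forall n, (0 < n)%N -> mu (lev n `\` cf_dom D g) = 0%E) <->
  mu (~` cf_dom D g) = 0%E.
Proof.
have mC : measurable (~` cf_dom D g) by apply: measurableC; exact: dom_measurable.
have mL n : measurable (lev n `\` cf_dom D g).
  by apply: measurableD; [exact: lev_measurable|exact: dom_measurable].
split=> [H|H n _]; last by apply: null_sub H => //; exact: subIsetr.
have -> : ~` cf_dom D g = \bigcup_n (lev n.+1 `\` cf_dom D g).
  apply/seteqP; split=> [x nx|x [n _ []//]].
  by have [n lx] := lev_exists x; exists n => //; split=> //; exact: lev_leq lx.
by apply: null_bigcup => // i; exact: H.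
Qed.

Lemma full_nullP : mu (~` Y) = 0%E <-> forall g, mu (~` cf_dom D g) = 0%E.
Proof.
have mC g : measurable (~` cf_dom D g) by apply: measurableC; exact: dom_measurable.
split=> [H g|H].
  apply: null_sub H => //; first by apply: measurableC; exact: full_measurable.
  by apply: subsetC => x; exact.
have [e eP] := countable_enum cG.
by rewrite (full_enum D eP) setC_bigcap; apply: null_bigcup.
Qed.

Lemma full_null_star : mu (~` Y) = 0%E <-> star_cond.
Proof.
rewrite full_nullP; split=> [H g n n0|H g].
  by apply/star_nullP; exact: (lev_dom_null g).2.
by apply/lev_dom_null => n n0; apply/star_nullP; exact: H.
Qed.

(** [cf_full D] is measurable and invariant, hence null or conull, and the second case is the limit
    condition. *)
Lemma not_star_full : ~ star_cond -> mu Y = 0%E.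
Proof.
move=> ns; have [//|/full_null_star] :=
  tail_ergodic cmu full_measurable (@full_invariant _ D).
by [].
Qed.

Lemma cvg_lev (E : set X) : measurable E -> mu (lev n `&` E) @[n --> \oo] --> mu E.
Proof.
move=> mE; have {2}-> : E = \bigcup_n (lev n `&` E) by rewrite -setI_bigcupl lev_cover setTI.
have mL n : measurable (lev n `&` E) by apply: measurableI => //; exact: lev_measurable.
apply: (@nondecreasing_cvg_mu _ _ _ mu (fun n => lev n `&` E)) => //.
  exact: bigcupT_measurable.
by move=> m k mk; apply/subsetPset; apply: setSI; exact: lev_leq.
Qed.

Lemma cvg_domL g : mu (cf_dom_level D m g) @[m --> \oo] --> mu (cf_dom D g).
Proof.
apply: (@nondecreasing_cvg_mu _ _ _ mu (fun m => cf_dom_level D m g)).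
- by move=> m; exact: domL_measurable.
- exact: dom_measurable.
- by move=> m k mk; apply/subsetPset; exact: domL_leq.
Qed.

Lemma domL_measure n g : mu (cf_dom_level D n g) =
  (#|` (ltrans g (F n) `&` F n)%fset|%:R * (c / (cprod D n)%:R))%:E.
Proof.
have := @lev_domL_measure n n g (leqnn n).
rewrite {1}/cf_prod big_geq// fset_mul1r => <-; congr (mu _).
by apply/esym/setIidr => x /domLP[].
Qed.

Lemma finite_measureP : (mu [set: X] < +oo)%E <->
  (limn (fun n => ((#|` F n|%:R /
     (\prod_(1 <= i < n.+1) #|` C i|)%N%:R : R)%:E)) < +oo)%E.
Proof.
set v := (fun n => _ : \bar R).
(* The n-th term is the mass of X_n divided by that of X_0. The intersection with [setT] puts it in
   the form handled by [cvg_lev]. *)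
have vE : v = fun n => (c^-1%:E * mu (lev n `&` setT))%E.
  apply/funext => n; rewrite setIT (lev_mass n cm) -EFinM /v; congr (_%:E).
  by rewrite -[\prod_(_ <= _ < _) _]/(cprod D n) mulrCA (mulrA _ c) mulVf ?mul1r// gt_eqF.
have : v @ \oo --> (c^-1%:E * mu [set: X])%E.
  by rewrite vE; apply: cvgeZl => //; exact: cvg_lev.
move/cvg_lim => ->//.
have ci0 : 0 < c^-1 by rewrite invr_gt0.
rewrite !ltey; split=> [/eqP H|/eqP H]; apply/eqP => E; apply: H.
  by move: E; case: (mu _) => [r//|//|]; rewrite mulrNy gtr0_sg// mul1e.
by rewrite E mulry gtr0_sg// mul1e.
Qed.

(** Finiteness of [mu] lets the masses of X_m^g and of X_m both converge to finite limits, so the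
    limit of the quotient is the proportion of the space on which [g] is defined. *)
Lemma folner_star : (mu [set: X] < +oo)%E -> star_cond <-> folner R F.
Proof.
move=> fin; rewrite -full_null_star full_nullP.
suff H g : mu (~` cf_dom D g) = 0%E <->
    (fun n => (#|` (ltrans g (F n) `&` F n)%fset|)%:R / (#|` F n|)%:R : R)
      @ \oo --> (1 : R).
  by split=> K g; apply/H; exact: K.
set u := (fun n => _ : R).
have finA (A : set X) : measurable A -> mu A \is a fin_num.
  move=> mA; rewrite ge0_fin_numE//; apply: le_lt_trans fin.
  by apply: le_measure; rewrite ?inE.
have mD := dom_measurable g.
pose q := fine (mu (cf_dom D g)) / fine (mu [set: X]).
have X0 : fine (mu [set: X]) != 0.
  case: cmu => _ mu0 _ _; apply/eqP => E; apply: mu0.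
  by rewrite -(fineK (finA _ measurableT)) E.
have uq : u @ \oo --> q.
  have H1 : fine (mu (cf_dom_level D m g)) @[m --> \oo] --> fine (mu (cf_dom D g)).
    by apply: fine_cvg; rewrite fineK ?finA//; exact: cvg_domL.
  have H2 : fine (mu (lev m `&` setT)) @[m --> \oo] --> fine (mu [set: X]).
    by apply: fine_cvg; rewrite fineK ?finA//; exact: cvg_lev.
  have H : fine (mu (cf_dom_level D m g)) / fine (mu (lev m `&` setT)) @[m --> \oo] --> q.
    exact: cvgM H1 (cvgV X0 H2).
  apply: cvg_trans H; apply: near_eq_cvg.
  near=> m; rewrite /= setIT domL_measure (lev_mass m cm) /= /u.
  have Bm0 : (cprod D m)%:R != 0 :> R by rewrite pnatr_eq0 -lt0n cprod_gt0.
  have Fm0 : #|` F m|%:R != 0 :> R by rewrite pnatr_eq0 -lt0n card_F_gt0.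
  have cn0 : c != 0 by rewrite gt_eqF.
  by field; rewrite Bm0 Fm0 cn0.
have q1 : q = 1 <-> mu (~` cf_dom D g) = 0%E.
  have dD : (mu [set: X] = mu (cf_dom D g) + mu (~` cf_dom D g))%E.
    by rewrite -measureU ?setUv ?setICr//; exact: measurableC.
  rewrite /q; split=> [/divr1_eq H|E].
    have : (mu [set: X] - mu (cf_dom D g))%E = 0%E.
      by rewrite -(fineK (finA _ measurableT)) -(fineK (finA _ mD)) -EFinB H subrr.
    by rewrite dD addeAC subee ?finA// add0e.
  by rewrite -[in X in X / _](adde0 (mu _)) -E -dD divff.
split=> [/q1 <-//|u1].
by apply/q1; exact: cvg_unique uq u1.
Unshelve. all: by end_near. Qed.

End MeasureOfDomains.

(** * Ergodicity, conservativity, funny rank one *)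

Lemma cvge0_ltP (R : realType) (u : nat -> \bar R) : (forall n, 0 <= u n)%E ->
  u @ \oo --> 0%E <-> forall e : R, 0 < e -> \forall n \near \oo, (u n < e%:E)%E.
Proof.
move=> u0; have finu n (e : R) : (u n < e%:E)%E -> u n \is a fin_num.
  by move=> ue; rewrite ge0_fin_numE// (lt_trans ue)// ltry.
split=> [/fine_cvgP[fu /cvgr0Pnorm_lt cu] e e0|H].
  near=> n; have fn : u n \is a fin_num by near: n.
  rewrite -(fineK fn) lte_fin; apply: le_lt_trans (ler_norm _) _.
  by near: n; exact: cu.
apply/fine_cvgP; split.
  by near=> n; apply: (finu _ 1); near: n; exact: H.
apply/cvgr0Pnorm_lt => e e0; near=> n.
have un : (u n < e%:E)%E by near: n; exact: H.
by rewrite /= ger0_norm ?fine_ge0// -lte_fin fineK// (finu _ e).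
Unshelve. all: by end_near. Qed.

Section Dynamics.
Context {R : realType} {G : groupType} (D : cf_seq G).
Local Notation F := (cfF D).
Local Notation C := (cfC D).
Local Notation X := (cf_space D).
Local Notation Y := (cf_full D).
Local Notation T := (cf_action D).
Implicit Types (x y z : X) (n m k N : nat) (f g h : G).

Hypothesis cG : countable [set: G].
Variables (mu : {measure set X -> \bar R}) (c : R).
Hypotheses (c0 : 0 < c) (cm : cyl_mass mu c).

Let cmu : cf_measure mu := mass_cf_measure c0 cm.
Let mY : measurable Y := full_measurable cG.

(** Extending by the identity gives a transformation of the whole space, as [relation_invariant]
    quantifies over total Borel bijections. *)
Definition act_ext g x : X := if x \in Y then T g x else x.

Lemma act_ext_full g x : Y x -> act_ext g x = T g x.
Proof. by move=> Yx; rewrite /act_ext mem_set. Qed.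

Lemma act_ext_out g x : ~ Y x -> act_ext g x = x.
Proof. by move=> Yx; rewrite /act_ext memNset. Qed.

Lemma act_extK g : cancel (act_ext g) (act_ext g^-1%g).
Proof.
move=> x; have [Yx|nYx] := pselect (Y x); last by rewrite !act_ext_out.
by rewrite (act_ext_full g Yx) act_ext_full ?actK//; exact: act_full.
Qed.

Lemma act_ext_measurable g : measurable_fun [set: X] (act_ext g).
Proof.
apply: (@cyl_measurable_fun _ _ 0) => // n f _ fF; rewrite setTI.
(* Points having a cylinder whose part in [Y] is sent into [cyl n f]. This set is open and, by
   [act_local], cuts out the preimage within [Y]. *)
pose V := [set x : X | exists2 k, lev k x &
  forall z, Y z -> cyl k (hd k x) z -> cyl n f (T g z)].
have oV : open V.
  apply/openP => x [k lx H]; exists k => // y [ly hy]; exists k => // z Yz.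
  by rewrite hy; exact: H.
have -> : act_ext g @^-1` cyl n f = (Y `&` V) `|` (cyl n f `\` Y).
  apply/seteqP; split=> x /=.
    have [Yx|nYx] := pselect (Y x); last by rewrite act_ext_out//; right.
    rewrite act_ext_full// => H; left; split=> //.
    exact: (act_local Yx (@cyl_open _ D n f)).
  move=> [[Yx [k lx H]]|[xf nYx]]; last by rewrite act_ext_out.
  by rewrite act_ext_full//; apply: H.
apply: measurableU.
  by apply: measurableI => //; exact: open_cf_measurable.
by apply: measurableD => //; exact: cyl_measurable.
Qed.

Lemma act_image g (A : set X) : A `<=` Y -> T g @` A = act_ext g^-1%g @^-1` A.
Proof.
move=> AY; apply/seteqP; split=> [_ [x Ax <-]|x /= Ax].
  by rewrite /= -act_ext_full ?act_extK//; exact: AY.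
exists (act_ext g^-1%g x) => //; rewrite -act_ext_full; last exact: AY.
by rewrite -{1}(invgK g) act_extK.
Qed.

Lemma act_ext_borel g : borel_transformation (act_ext g).
Proof.
split; [|exact: act_ext_measurable|].
  exists (act_ext g^-1%g); first exact: act_extK.
  by move=> x; rewrite -{1}(invgK g) act_extK.
move=> A mA; rewrite (_ : _ @` _ = act_ext g^-1%g @^-1` A).
  by rewrite -[X in measurable X]setTI; exact: act_ext_measurable.
apply/seteqP; split=> [_ [x Ax <-]|x Ax]; first by rewrite /= act_extK.
by exists (act_ext g^-1%g x) => //; rewrite -{1}(invgK g) act_extK.
Qed.

Lemma act_preserving g (A : set X) : measurable A -> A `<=` Y ->
  measurable (T g @` A) /\ mu (T g @` A) = mu A.
Proof.
move=> mA AY; rewrite act_image//; split.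
  by rewrite -[X in measurable X]setTI; exact: act_ext_measurable.
case: cmu => inv _ _ _; apply: inv => //; first exact: act_ext_borel.
move=> x; have [Yx|nYx] := pselect (Y x).
  by rewrite act_ext_full//; apply/tailP; eexists; exact: actP.
by rewrite act_ext_out//; apply/tailP; exists 1%g; exact: shift1.
Qed.

Lemma act_ergodic : ergodic mu Y T.
Proof.
move=> A mA AY inv; apply: tail_ergodic => // x y /tailP[g s] Ax.
by rewrite -(inv g); exists x => //; apply: act_eq => //; exact: AY.
Qed.

(** * Conservativity *)

Lemma cprod_exp n : (2 ^ n <= cprod D n)%N.
Proof.
elim: n => [|n IH]; first by rewrite cprod0.
by rewrite cprodS expnSr leq_mul// cf_card_C.
Qed.

Lemma mass_small (e : R) : 0 < e -> exists n, c / (cprod D n)%:R < e.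
Proof.
move=> e0; exists (Num.truncn (c / e)).+1.
rewrite ltr_pdivrMr ?ltr0n ?cprod_gt0// mulrC -ltr_pdivrMr//.
apply: lt_le_trans (truncnS_gt _) _; rewrite ler_nat.
by apply: leq_trans (cprod_exp _); apply: ltnW; exact: ltn_expl.
Qed.

(* A set meeting each orbit at most once: the pieces of A in the cylinders of
   level n can all be moved disjointly into the single cylinder cyl n 1. *)
Lemma wandering_lev (A : set X) n : measurable A -> A `<=` Y ->
  (forall g, g != 1%g -> A `&` T g @` A = set0) ->
  (mu (A `&` lev n) <= (c / (cprod D n)%:R)%:E)%E.
Proof.
move=> mA AY wA.
have mAf f : measurable (A `&` cyl n f) by apply: measurableI => //; exact: cyl_measurable.
have AfY f : A `&` cyl n f `<=` Y by move=> x [/AY].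
have tA : trivIset [set` F n] (fun f => A `&` cyl n f).
  by move=> f g _ _ [x [[_ xf] [_ xg]]]; exact: cyl_eq xf xg.
have tB : trivIset [set` F n] (fun f => T f^-1%g @` (A `&` cyl n f)).
  move=> f g _ _ [_ [[x [Ax xf] <-] [y [Ay yg] E]]].
  apply: contrapT => /eqP fg.
  (* An overlap of the moved pieces gives [y = T (g * f^-1) x] with both points in [A], a forbidden
     return. *)
  have ne : (g * f^-1)%g != 1%g.
    by apply: contra fg => /eqP e; apply/eqP; rewrite -[LHS]mul1g -e mulgVK.
  suff : (A `&` T (g * f^-1)%g @` A) y by rewrite wA.
  split=> //; exists x => //; case: (@act_is_action _ D) => _ _ TM.
  by rewrite TM -?E ?actVK//; exact: AY.
rewrite levE setI_bigcupr measure_fin_bigcup//.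
have -> : (\sum_(f \in [set` F n]) mu (A `&` cyl n f) =
           \sum_(f \in [set` F n]) mu (T f^-1%g @` (A `&` cyl n f)))%E.
  by apply: eq_fsbigr => f _; have [_ ->] := act_preserving f^-1%g (mAf f) (AfY f).
rewrite -measure_fin_bigcup//; last first.
  by move=> f _; have [] := act_preserving f^-1%g (mAf f) (AfY f).
rewrite -(cm (cf_1F D n)); apply: le_measure; rewrite ?inE.
- apply: fin_bigcup_measurable => // f _.
  by have [] := act_preserving f^-1%g (mAf f) (AfY f).
- exact: cyl_measurable.
- move=> _ [f /= fF [x [Ax xf] <-]]; rewrite -(mulVg f).
  by apply: act_cyl => //; [exact: AY|rewrite mulVg; exact: cf_1F].
Qed.

Lemma wandering_null (A : set X) : measurable A -> A `<=` Y ->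
  (forall g, g != 1%g -> A `&` T g @` A = set0) -> mu A = 0%E.
Proof.
move=> mA AY wA.
have mL N : measurable (A `&` lev N) by apply: measurableI => //; exact: lev_measurable.
have -> : A = \bigcup_N (A `&` lev N) by rewrite -setI_bigcupr lev_cover setIT.
apply: null_bigcup => // N; apply/eqP; rewrite eq_le measure_ge0 andbT.
apply/lee_addgt0Pr => e e0; rewrite add0e; have [n ne] := mass_small e0.
(* Enlarging X_N to a higher level only increases the left side, while the bound [c / cprod]
   decreases to 0. *)
apply: (@le_trans _ _ (mu (A `&` lev (maxn n N)))).
  by apply: le_measure; rewrite ?inE//; apply: setIS; exact: (lev_leq (leq_maxr n N)).
apply: le_trans (wandering_lev _ mA AY wA) _.
rewrite lee_fin; apply: le_trans (ltW ne).
rewrite ler_pM2l// lef_pV2 ?posrE ?ltr0n ?cprod_gt0// ler_nat.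
rewrite maxnE; elim: (N - n)%N => [|k IH]; first by rewrite addn0.
by rewrite addnS; apply: leq_trans IH _; rewrite cprodS leq_pmulr// C_gt0.
Qed.

(** If every return of [A] to itself were null, removing these countably many null sets would leave
    a set with no return at all, which is null by [wandering_null]. *)
Lemma act_conservative : conservative mu Y T.
Proof.
move=> A mA AY A0; apply: contrapT => H.
have mT g : measurable (T g @` A) by have [] := act_preserving g mA AY.
have nullA g : g != 1%g -> mu (A `&` T g @` A) = 0%E.
  move=> g1; apply/eqP; rewrite eq_le measure_ge0 andbT leNgt; apply/negP => Ag.
  by apply: H; exists g => //; exact/eqP.
have [e eP] := countable_enum cG.
pose B i := if e i == 1%g then set0 else A `&` T (e i) @` A.
have mB i : measurable (B i).
  by rewrite /B; case: ifP => // _; exact: measurableI.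
have B0 : mu (\bigcup_i B i) = 0%E.
  apply: null_bigcup => // i; rewrite /B; case: ifPn => [_|/nullA//].
  by rewrite measure0.
have mUB : measurable (\bigcup_i B i) by exact: bigcupT_measurable.
pose A' := A `\` \bigcup_i B i.
have mA' : measurable A' by exact: measurableD.
have A'0 : mu A' = 0%E.
  apply: wandering_null => //; first by move=> x [/AY].
  move=> g g1; apply/seteqP; split=> // x [[Ax nB] [y [Ay _] yx]].
  have [i ei] := eP g; apply: nB; exists i => //.
  by rewrite /B ei (negbTE g1); split=> //; exists y.
suff : (mu A <= 0)%E by rewrite leNgt A0.
have -> : A = A' `|` \bigcup_i B i.
  apply/seteqP; split=> [x Ax|x [[]//|[i _]]].
    by have [xB|xB] := pselect ((\bigcup_i B i) x); [right|left].
  by rewrite /B; case: ifP => // _ [].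
apply: le_trans (measureU2 mu mA' mUB) _.
by rewrite -[X in (X + _)%E]/(mu A') A'0 -[X in (_ + X)%E]/(mu _) B0 adde0.
Qed.

(* Finite unions of cylinders of one level, described without choosing the
   list of cylinders. *)
Definition elementary (U : set X) := exists N, U `<=` lev N /\
  forall x, U x -> cyl N (hd N x) `<=` U.

Lemma elementary_leq N n (U : set X) : (N <= n)%N -> U `<=` lev N ->
  (forall x, U x -> cyl N (hd N x) `<=` U) ->
  U = \bigcup_(f in [set` [fset f in F n | `[< (cyl n f `<=` U)%classic >]]%fset]) cyl n f.
Proof.
move=> Nn UN Ucyl; apply/seteqP; split=> [x Ux|x [f /=]]; last first.
  by rewrite !inE /= => /andP[_ /asboolP]; exact.
have lx := lev_leq Nn (UN _ Ux).
exists (hd n x) => //=; rewrite !inE /= hdF//=; apply/asboolP.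
by apply: subset_trans (Ucyl _ Ux); apply: cyl_sub => //; exact: UN.
Qed.

Lemma elementary_measurable U : elementary U -> measurable U.
Proof.
move=> [N [UN Uc]]; rewrite (elementary_leq (leqnn N) UN Uc).
by apply: fin_bigcup_measurable => // f _; exact: cyl_measurable.
Qed.

Lemma elementary0 : elementary set0.
Proof. by exists 0%N; split; [exact: sub0set|]. Qed.

Lemma elementary_raise N n (U : set X) : (N <= n)%N ->
  (U `<=` lev N /\ forall x, U x -> cyl N (hd N x) `<=` U) ->
  U `<=` lev n /\ forall x, U x -> cyl n (hd n x) `<=` U.
Proof.
move=> Nn [UN Uc]; split; first by apply: subset_trans UN _; exact: lev_leq.
by move=> x Ux; apply: subset_trans (Uc _ Ux); apply: cyl_sub => //; exact: UN.
Qed.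

Lemma elementaryU U V : elementary U -> elementary V -> elementary (U `|` V).
Proof.
move=> [N UN] [M VM].
have [U1 U2] := elementary_raise (leq_maxl N M) UN.
have [V1 V2] := elementary_raise (leq_maxr N M) VM.
exists (maxn N M); split=> [x [/U1//|/V1//]|x [Ux|Vx]] y xy.
  by left; exact: U2 Ux _ xy.
by right; exact: V2 Vx _ xy.
Qed.

Lemma elementaryD U V : elementary U -> elementary V -> elementary (U `\` V).
Proof.
move=> [N UN] [M VM].
have [U1 U2] := elementary_raise (leq_maxl N M) UN.
have [V1 V2] := elementary_raise (leq_maxr N M) VM.
exists (maxn N M); split=> [x [/U1//]|x [Ux nVx]] y xy.
split; first exact: U2 Ux _ xy.
move=> Vy; apply: nVx; apply: (V2 _ Vy).
by split; [exact: U1|case: xy].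
Qed.

Lemma lev_elementary N : elementary (lev N).
Proof. by exists N; split=> // x lx y []. Qed.

Lemma cyl_elementary n f : elementary (cyl n f).
Proof. by exists n; split=> [x []//|x [_ ->]]. Qed.

(** * Approximation by finite unions of cylinders *)

Definition approximable (A : set X) :=
  forall e : R, 0 < e -> exists2 U, elementary U & (mu (A `+` U) < e%:E)%E.

Lemma setY_measurable (A U : set X) : measurable A -> elementary U -> measurable (A `+` U).
Proof.
move=> mA /elementary_measurable mU.
by rewrite /setY; apply: measurableU; exact: measurableD.
Qed.

Lemma le_split (A B E : set X) (e : R) : measurable A -> measurable B -> measurable E ->
  A `<=` B `|` E -> (mu B < (e / 2)%:E)%E -> (mu E < (e / 2)%:E)%E -> (mu A < e%:E)%E.
Proof.
move=> mA mB mE AB Be Ee; apply: (@le_lt_trans _ _ (mu B + mu E)%E).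
  apply: le_trans (measureU2 mu mB mE).
  by apply: le_measure; rewrite ?inE//; exact: measurableU.
by rewrite [e]splitr EFinD lteD.
Qed.

Lemma approximableU (A B : set X) : measurable A -> measurable B ->
  approximable A -> approximable B -> approximable (A `|` B).
Proof.
move=> mA mB aA aB e e0; have e2 : 0 < e / 2 by exact: divr_gt0.
have [U eU AU] := aA _ e2; have [V eV BV] := aB _ e2.
exists (U `|` V); first exact: elementaryU.
apply: (le_split _ _ _ _ AU BV); try exact: setY_measurable.
  by apply: setY_measurable; [exact: measurableU|exact: elementaryU].
move=> x; rewrite /setY /=.
move=> [[[Ax|Bx] nUV]|[[Ux|Vx] nAB]].
- by left; left; split=> // Ux; apply: nUV; left.
- by right; left; split=> // Vx; apply: nUV; right.
- by left; right; split=> // Ax; apply: nAB; left.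
- by right; right; split=> // Bx; apply: nAB; right.
Qed.

Lemma small_tail (A : nat -> set X) (e : R) : (forall i, measurable (A i)) ->
  (mu (A 0%N) < +oo)%E -> (forall i, A i.+1 `<=` A i) -> \bigcap_i A i = set0 ->
  0 < e -> exists i, (mu (A i) < e%:E)%E.
Proof.
move=> mA fA dA iA e0.
have ni : {homo A : n m / (n <= m)%N >-> (m <= n)%O}.
  move=> n m /subnKC <-; elim: (m - n)%N => [|k IH]; first by rewrite addn0.
  by rewrite addnS; apply: le_trans IH; apply/subsetPset; exact: dA.
have := @nonincreasing_cvg_mu _ _ _ mu A fA mA.
rewrite iA measure0 => /(_ measurable0 ni) cv.
have := (cvge0_ltP (fun i => measure_ge0 mu (A i))).1 cv e e0.
by move=> [i _ /(_ i (leqnn i))]; exists i.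
Qed.

(** The measurable sets with this property form a sigma-algebra containing the cylinders. Cutting by
    X_N keeps complements elementary and gives the finite mass that continuity from above
    requires. *)
Lemma approximable_lev N (A : set X) : measurable A -> approximable (A `&` lev N).
Proof.
have mL := @lev_measurable _ D N.
have finL : (mu (lev N) < +oo)%E by rewrite (lev_mass N cm) ltry.
suff sub : @measurable _ X `<=` [set A | measurable A /\ approximable (A `&` lev N)].
  by move=> mA; have [] := sub A mA.
rewrite [X in X `<=` _](measurable_cyls D 0); apply: smallest_sub; last first.
  move=> _ [->|[n [f [_ ->]]]]; split.
  - exact: measurable0.
  - move=> e e0; exists set0; first exact: elementary0.
    by rewrite set0I setYK measure0 lte_fin.
  - exact: cyl_measurable.
  - move=> e e0; exists (cyl n f `&` lev N); last by rewrite setYK measure0 lte_fin.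
    (* Elementary sets have been shown stable under differences, so the intersection is written as a
       double difference. *)
    rewrite -(setDD (cyl n f)); apply: elementaryD; first exact: cyl_elementary.
    by apply: elementaryD; [exact: cyl_elementary|exact: lev_elementary].
split.
- split; first exact: measurable0.
  move=> e e0; exists set0; first exact: elementary0.
  by rewrite set0I setYK measure0 lte_fin.
- move=> {}A [mA aA]; split; first by rewrite setTD; exact: measurableC.
  move=> e e0; have [U eU AU] := aA e e0.
  have eL : elementary (lev N `\` U) by apply: elementaryD => //; exact: lev_elementary.
  exists (lev N `\` U) => //; apply: le_lt_trans AU.
  apply: le_measure; rewrite ?inE.
  - apply: setY_measurable => //; apply: measurableI => //.
    by rewrite setTD; exact: measurableC.
  - by apply: setY_measurable => //; exact: measurableI.
  - move=> x [[[[_ nAx] lx] nLU]|[[lx nUx] nAL]].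
      right; split; last by move=> [].
      by apply: contrapT => nUx; apply: nLU.
    left; split=> //; split=> //.
    by apply: contrapT => nAx; apply: nAL.
- move=> {}A HA; have mA i : measurable (A i) by case: (HA i).
  have mUA : measurable (\bigcup_i A i) by exact: bigcupT_measurable.
  split=> // e e0; have e2 : 0 < e / 2 by exact: divr_gt0.
  (* [P k] involves finitely many of the sets and inherits approximability; the rest [Q k] decreases
     to the empty set within X_N, so half of [e] eventually covers it. *)
  pose P k := \big[setU/set0]_(i < k) A i `&` lev N.
  have mP k : measurable (P k).
    by apply: measurableI => //; apply: bigsetU_measurable.
  have aP k : approximable (P k).
    elim: k => [|k IH].
      move=> d d0; exists set0; first exact: elementary0.
      by rewrite /P big_ord0 set0I setYK measure0 lte_fin.
    rewrite /P big_ord_recr /= setIUl; apply: approximableU => //; first exact: mP.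
      exact: measurableI.
    by case: (HA k).
  pose Q k := (\bigcup_i A i `&` lev N) `\` P k.
  have mQ k : measurable (Q k) by apply: measurableD => //; exact: measurableI.
  have [||||k Qk] := @small_tail Q (e / 2) mQ.
  - apply: le_lt_trans finL; apply: le_measure; rewrite ?inE//.
    by move=> x [[]].
  - move=> i x [AL nP]; split=> // -[Pi lx]; apply: nP; split=> //.
    by rewrite big_ord_recr; left.
  - apply/seteqP; split=> // x H; have [[[i _ Aix] lx] _] := H 0%N I.
    have [_ []] := H i.+1 I; split=> //.
    by rewrite big_ord_recr /=; right.
  - exact: e2.
  have [U eU PU] := aP k _ e2; exists U => //.
  apply: (le_split _ _ _ _ Qk PU) => //; try exact: setY_measurable.
    by apply: setY_measurable => //; exact: measurableI.
  move=> x [[AL nU]|[Ux nAL]].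
    by have [Px|nPx] := pselect (P k x); [right; left|left].
  right; right; split=> // -[Px lx]; apply: nAL; split=> //.
  move: Px; rewrite -bigcup_mkord => -[i _ Aix]; by exists i.
Qed.

Lemma approximable_finite (A : set X) : measurable A -> (mu A < +oo)%E -> approximable A.
Proof.
move=> mA fA e e0; have e2 : 0 < e / 2 by exact: divr_gt0.
have mAl N : measurable (A `\` lev N) by apply: measurableD => //; exact: lev_measurable.
(* Since [A] has finite measure and the X_N exhaust the space, the part of [A] outside X_N becomes
   small, leaving [approximable_lev] for the rest. *)
have [||||N AN] := @small_tail (fun N => A `\` lev N) (e / 2) mAl.
- by apply: le_lt_trans fA; apply: le_measure; rewrite ?inE//; exact: subDsetl.
- by move=> i; apply: setDS; exact: lev_leq.
- apply/seteqP; split=> // x H; have [n lx] := lev_exists x.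
  by have [] := H n I.
- exact: e2.
have [U eU AU] := approximable_lev N mA e2; exists U => //.
have mAL : measurable (A `&` lev N) by apply: measurableI => //; exact: lev_measurable.
apply: (le_split _ _ _ _ AN AU) => //; try exact: setY_measurable.
move=> x [[Ax nUx]|[Ux nAx]].
  have [lx|nlx] := pselect (lev N x); last by left.
  by right; left.
by right; right; split=> // -[].
Qed.

(** * Funny rank one *)

Lemma act_measure_preserving : mu (~` Y) = 0%E -> measure_preserving_action mu Y T.
Proof.
move=> Y0; split=> //; first exact: act_is_action.
by move=> g A mA AY; exact: act_preserving.
Qed.

Lemma act_base n g : g \in F n -> T g @` (cyl n 1%g `&` Y) = cyl n g `&` Y.
Proof.
move=> gF; apply/seteqP; split=> [_ [x [x1 Yx] <-]|x [xg Yx]].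
  split; last exact: act_full.
  by rewrite -[g in cyl n g]mulg1; apply: act_cyl; rewrite // mulg1.
exists (T g^-1%g x); last exact: actVK.
split; last exact: act_full.
by rewrite -(mulVg g); apply: act_cyl; rewrite // mulVg; exact: cf_1F.
Qed.

Lemma act_funny_rank_one : mu (~` Y) = 0%E -> funny_rank_one mu Y T.
Proof.
move=> Y0; split.
- exact: cf_standard_borel.
- by case: cmu.
- exact: act_measure_preserving.
(* Translating this base by [g] in F_n gives the cylinder of [g] within [Y], so unions of tower
   levels are elementary sets up to the null complement of [Y]. *)
exists (fun n => cyl n 1%g `&` Y), F; split.
- move=> n; split.
  + by apply: measurableI => //; exact: cyl_measurable.
  + exact: subIsetr.
  + apply: (@le_lt_trans _ _ (mu (cyl n 1%g))); last exact: cyl_mass_lty cm.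
    apply: le_measure; rewrite ?inE//; last exact: cyl_measurable.
    by apply: measurableI => //; exact: cyl_measurable.
- move=> n f g /= fF gF; rewrite !act_base// => -[x [[xf _] [xg _]]].
  exact: cyl_eq xf xg.
- move=> A mA fA; set u := (X in X @ \oo --> _).
  have u0 n : (0 <= u n)%E by apply: le_ereal_inf_tmp => _ [s _ <-]; exact: measure_ge0.
  suff H (e : R) : 0 < e -> \forall n \near \oo, (u n < e%:E)%E.
    exact/(cvge0_ltP u0).
  move=> e0; have [U [N [UN Uc]] AU] := approximable_finite mA fA e0.
  (* An elementary set of level [N] is a union of cylinders at every [n >= N], so one approximation
     bounds all later infima. *)
  exists N => // n /= Nn; apply: le_lt_trans AU.
  pose s := [fset f in F n | `[< (cyl n f `<=` U)%classic >]]%fset.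
  have sF : (s `<=` F n)%fset by apply/fsubsetP => f; rewrite !inE /= => /andP[].
  apply: (@le_trans _ _ (mu (A `+` \bigcup_(g in [set` s]) (T g @` (cyl n 1%g `&` Y))))).
    by apply: ereal_inf_lbound; exists s.
  have UE := elementary_leq Nn UN Uc; rewrite -/s in UE.
  have -> : \bigcup_(g in [set` s]) (T g @` (cyl n 1%g `&` Y)) = U `&` Y.
    rewrite UE setI_bigcupl; apply: eq_bigcupr => g gs.
    by apply: act_base; exact: (fsubsetP sF).
  have eU : elementary U by exists N.
  have mU := elementary_measurable eU.
  have mAU : measurable (A `+` U) by exact: setY_measurable.
  apply: (@le_trans _ _ (mu (A `+` U) + mu (~` Y))%E); last by rewrite Y0 adde0.
  apply: le_trans (measureU2 mu mAU (measurableC mY)).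
  apply: le_measure; rewrite ?inE.
  + by rewrite /setY; apply: measurableU; apply: measurableD => //; exact: measurableI.
  + by apply: measurableU => //; exact: measurableC.
  + move=> x [[Ax nUY]|[[Ux Yx] nAx]]; last by left; right.
    have [Yx|nYx] := pselect (Y x); last by right.
    by left; left; split=> // Ux; apply: nUY.
Qed.

End Dynamics.

Theorem theorem1p5 (R : realType) (G : groupType)
    (Gcountable : countable [set: G]) (Ginfinite : infinite_set [set: G])
    (D : cf_seq G) :
  let star : Prop := forall (g : G) (n : nat), (0 < n)%N ->
    (fun m => (#|` (ltrans g (cf_prod D n m) `&` cfF D m)%fset|)%:R
                / (cf_card D n m)%:R : R) @ \oo --> (1 : R) in
  (* standing assertions: the space is a locally compact Cantor space and the
     tail relation is a countable equivalence relation *)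
  (locally_compact_cantor R (cf_space D) /\
   countable_equivalence (cf_tail D)) /\
  (* (i) *)
  (forall x : cf_space D, dense [set y | cf_tail D x y]) /\
  (* (ii) *)
  ((exists mu : {measure set (cf_space D) -> \bar R}, cf_measure mu) /\
   (forall mu nu : {measure set (cf_space D) -> \bar R}, cf_measure mu -> cf_measure nu ->
      exists2 c : R, 0 < c &
        forall A : set (cf_space D), measurable A -> nu A = (c%:E * mu A)%E)) /\
  (* (iv) *)
  ([/\ Gdelta (cf_full D),
       invariant_set (cf_tail D) (cf_full D),
       (forall g x y, cf_full D x -> cf_translate D g x y <-> cf_action D g x = y),
       topological_action (cf_full D) (cf_action D) &
       free_action (cf_full D) (cf_action D)] /\
   (forall x y, cf_full D x -> cf_full D y ->
      (exists g, cf_action D g x = y) <-> cf_tail D x y)) /\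
  (* (v) *)
  (cf_full D = [set: cf_space D] <->
   forall (g : G) (n : nat), (0 < n)%N ->
     exists2 m, (n < m)%N & (ltrans g (cf_prod D n m) `<=` cfF D m)%fset) /\
  forall mu : {measure set (cf_space D) -> \bar R}, cf_measure mu ->
  [/\
  (* (iii) *)
      (mu [set: cf_space D] < +oo)%E <->
        (limn (fun n => ((#|` cfF D n|)%:R /
           (\prod_(1 <= i < n.+1) #|` cfC D i|)%N%:R : R)%:E) < +oo)%E,
  (* (vi) *)
      (mu (~` cf_full D) = 0%E <-> star) /\ (~ star -> mu (cf_full D) = 0%E),
  (* (vii) *)
      (mu [set: cf_space D] < +oo)%E -> (star <-> folner R (cfF D)) &
  (* (viii) *)
      star -> [/\ ergodic mu (cf_full D) (cf_action D),
                  conservative mu (cf_full D) (cf_action D) &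
                  funny_rank_one mu (cf_full D) (cf_action D)]].
Proof.
move=> star; split; [split|split; [|split; [|split; [|split]]]].
- split; first exact: cf_locally_compact.
  + by apply: zero_dimension_totally_disconnected; exact: cf_zero_dimensional.
  + exact: cf_perfect.
  + exact: cf_metrizable.
- exact: tail_countable_equivalence.
- exact: tail_dense.
- by split; [exact: cf_measure_exists|exact: cf_measure_unique].
- split; last exact: orbit_tail.
  split.
  + exact: full_Gdelta.
  + exact: full_invariant.
  + exact: translate_actP.
  + by split; [exact: act_is_action|exact: act_continuous].
  + exact: act_free.
- exact: full_setTP.
- move=> mu cmu; have [c c0 cm] := cf_measure_mass cmu.
  have starE : mu (~` cf_full D) = 0%E <-> star := full_null_star Gcountable c0 cm.
  have nstar : ~ star -> mu (cf_full D) = 0%E := not_star_full Gcountable c0 cm.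
  have folE : (mu [set: cf_space D] < +oo)%E -> star <-> folner R (cfF D) :=
    folner_star Gcountable c0 cm.
  split.
  + exact: finite_measureP c0 cm.
  + by split.
  + exact: folE.
  + move=> /starE Y0; split.
    * exact (act_ergodic c0 cm).
    * exact (act_conservative Gcountable c0 cm).
    * exact (act_funny_rank_one Gcountable c0 cm Y0).
Qed.
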